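(* Let $P=\langle a,b\mid b^{-1}a^2b=a^{-2},\ a^{-1}b^2a=b^{-2}\rangle$ be the Promislow group, and let $B(r)\subseteq P$ be the word ball of radius $r$ centred at $1$ with respect to the generators $a,b$. For each positive integer $n$ there is an explicit constant $D_{\mathrm u}(n)\le 4^{n}\,\mathrm{poly}(n)$ such that if $\mathbb F_2[P]$ contains a nontrivial unit $\alpha$ with $|\operatorname{supp}\alpha|+|\operatorname{supp}\alpha^{-1}|=n$, then it contains a nontrivial unit $\alpha'$ with $|\operatorname{supp}\alpha'|+|\operatorname{supp}\alpha'^{-1}|=n$ and $\operatorname{supp}\alpha',\ \operatorname{supp}\alpha'^{-1}\subseteq B(D_{\mathrm u}(n))$. Consequently, it is decidable, given $n$, whether $\mathbb F_2[P]$ has a nontrivial unit of total support $n$, and the least total support of a nontrivial unit of $\mathbb F_2[P]$ is computable in principle.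
   Context: $B(r)$ is the set of elements expressible as words of length at most $r$ in $a^{\pm1},b^{\pm1}$. The support of an element of $\mathbb F_2[P]$ is the finite set of group elements with nonzero coefficient. A unit of $\mathbb F_2[P]$ is trivial if it is a group element (support of size $1$), and nontrivial otherwise. The total support of a unit $\alpha$ is $|\operatorname{supp}\alpha|+|\operatorname{supp}\alpha^{-1}|$. Here $\mathrm{poly}(n)$ denotes a fixed polynomial in $n$ (independent of the unit), and ''explicit'' means that $n\mapsto D_{\mathrm u}(n)$ is a computable function. *)

(* Defs.v *)
From HB Require Import structures.
From mathcomp Require Import all_boot all_order all_algebra.
From mathcomp Require Import generic_quotient finmap.
From mathcomp.classical Require Import boolp.
From mathcomp.multinomials Require Import monalg.

Set Implicit Arguments.
Unset Strict Implicit.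
Unset Printing Implicit Defensive.

Import GRing.Theory.
Local Open Scope quotient_scope.
Local Open Scope ring_scope.

Section Presentation.

Variable T : choiceType.

(* The letter (x, false) stands for the generator x, (x, true) for x^-1. *)
Definition word : Type := seq (T * bool).

HB.instance Definition _ := Choice.on word.

Definition letter_inv (l : T * bool) : T * bool := (l.1, ~~ l.2).

Definition word_inv (w : word) : word := rev (map letter_inv w).

Variable rels : seq (word * word).

Inductive word_eq : word -> word -> Prop :=
| word_eq_refl u : word_eq u u
| word_eq_sym u v : word_eq u v -> word_eq v u
| word_eq_trans u v w : word_eq u v -> word_eq v w -> word_eq u w
| word_eq_cat u u' v v' :
    word_eq u u' -> word_eq v v' -> word_eq (u ++ v) (u' ++ v')
| word_eq_cancel l : word_eq [:: l; letter_inv l] [::]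
| word_eq_rel r : r \in rels -> word_eq r.1 r.2.

Definition word_eqb (u v : word) : bool := `[< word_eq u v >].

Lemma word_eqb_refl : reflexive word_eqb.
Proof. by move=> u; apply/asboolP; apply: word_eq_refl. Qed.

Lemma word_eqb_sym : symmetric word_eqb.
Proof. by move=> u v; apply/asboolP/asboolP; apply: word_eq_sym. Qed.

Lemma word_eqb_trans : transitive word_eqb.
Proof.
move=> v u w /asboolP uv /asboolP vw; apply/asboolP.
exact: word_eq_trans uv vw.
Qed.

Canonical word_equiv := EquivRel word_eqb
  word_eqb_refl word_eqb_sym word_eqb_trans.

(* The group < T | u = v for (u, v) in rels >. *)
Definition presented := {eq_quot word_equiv}.

HB.instance Definition _ := Choice.on presented.

Definition of_word (w : word) : presented := \pi w.

Lemma of_wordP u v : reflect (word_eq u v) (of_word u == of_word v).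
Proof. by rewrite /of_word eqmodE; exact: asboolP. Qed.

Lemma word_invK : involutive word_inv.
Proof.
move=> w; rewrite /word_inv map_rev revK -map_comp map_id_in // => -[x e] _.
by rewrite /letter_inv /= negbK.
Qed.

Lemma word_eq_mulV w : word_eq (w ++ word_inv w) [::].
Proof.
elim: w => [|l w IH]; first exact: word_eq_refl.
rewrite /word_inv /= rev_cons -cats1 -/(word_inv w) -cat1s catA.
apply: word_eq_trans (word_eq_cancel l).
rewrite -[X in word_eq _ X]/([:: l] ++ [::] ++ [:: letter_inv l]) -!catA.
apply: word_eq_cat; first exact: word_eq_refl.
by rewrite catA; apply: word_eq_cat => //; apply: word_eq_refl.
Qed.

Lemma word_eq_inv u v : word_eq u v -> word_eq (word_inv u) (word_inv v).
Proof.
move=> uv; apply: (@word_eq_trans _ (word_inv u ++ v ++ word_inv v)).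
  rewrite -[X in word_eq X _]cats0.
  apply: word_eq_cat; first exact: word_eq_refl.
  exact: word_eq_sym (word_eq_mulV v).
rewrite catA -[X in word_eq _ X]cat0s.
apply: word_eq_cat; last exact: word_eq_refl.
apply: word_eq_trans (word_eq_mulV (word_inv u)).
by rewrite word_invK; apply: word_eq_cat (word_eq_sym uv); apply: word_eq_refl.
Qed.

Definition presented_one : presented := of_word [::].
Definition presented_mul (g h : presented) : presented :=
  of_word (repr g ++ repr h).
Definition presented_inv (g : presented) : presented :=
  of_word (word_inv (repr g)).

Lemma word_eq_repr w : word_eq (repr (of_word w)) w.
Proof. by apply/of_wordP; rewrite /of_word reprK. Qed.

Lemma presented_mulE u v :
  presented_mul (of_word u) (of_word v) = of_word (u ++ v).
Proof. by apply/eqP/of_wordP; apply: word_eq_cat; exact: word_eq_repr. Qed.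

Lemma presented_invE u : presented_inv (of_word u) = of_word (word_inv u).
Proof. by apply/eqP/of_wordP; apply: word_eq_inv; exact: word_eq_repr. Qed.

Lemma of_word_repr g : of_word (repr g) = g.
Proof. exact: reprK. Qed.

Lemma presented_mulA : associative presented_mul.
Proof.
move=> x y z; rewrite -(of_word_repr x) -(of_word_repr y) -(of_word_repr z).
by rewrite !presented_mulE catA.
Qed.

Lemma presented_mul1x : left_id presented_one presented_mul.
Proof. by move=> x; rewrite -(of_word_repr x) presented_mulE. Qed.

Lemma presented_mulx1 : right_id presented_one presented_mul.
Proof. by move=> x; rewrite -(of_word_repr x) presented_mulE cats0. Qed.

Lemma presented_mulxV : right_inverse presented_one presented_inv presented_mul.
Proof.
move=> x; rewrite -(of_word_repr x) presented_invE presented_mulE.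
by apply/eqP/of_wordP; exact: word_eq_mulV.
Qed.

Lemma presented_mulVx : left_inverse presented_one presented_inv presented_mul.
Proof.
move=> x; rewrite -(of_word_repr x) presented_invE presented_mulE.
apply/eqP/of_wordP.
by rewrite -[X in _ ++ X]word_invK; exact: word_eq_mulV.
Qed.

HB.instance Definition _ := isGroup.Build presented
  presented_mulA presented_mul1x presented_mulx1 presented_mulVx presented_mulxV.

Lemma of_wordM u v : of_word (u ++ v) = (of_word u * of_word v)%g.
Proof. exact: esym (presented_mulE u v). Qed.

Lemma of_wordV u : of_word (word_inv u) = (of_word u)^-1%g.
Proof. exact: esym (presented_invE u). Qed.

Definition word_ball (r : nat) (g : presented) : Prop :=
  exists2 w : word, (size w <= r)%N & of_word w = g.

End Presentation.

(* {malg R[G]} is the module of finitely supported functions G -> R; its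
   library product requires a monoid in which 1 has only the trivial
   factorization, hence the separate type for the group algebra. *)
Definition group_algebra (R : nzRingType) (G : groupType) : Type := {malg R[G]}.

HB.instance Definition _ (R : nzRingType) (G : groupType) :=
  GRing.Lmodule.copy (group_algebra R G) {malg R[G]}.

Section GroupAlgebra.

Variables (R : nzRingType) (G : groupType).

Local Notation RG := (group_algebra R G).

Implicit Types (g : RG) (k : G).

Definition supp g : {fset G} := msupp (g : {malg R[G]}).

Definition gbasis k : RG := << k >>.

Definition galg_mul g1 g2 : RG :=
  \sum_(k1 <- msupp g1) \sum_(k2 <- msupp g2)
    << g1@_k1 * g2@_k2 *g (k1 * k2)%g >>.

Definition galg_one : RG := gbasis 1%g.

Lemma galg_mulE (d1 d2 : {fset G}) g1 g2 :
  (msupp g1 `<=` d1)%fset -> (msupp g2 `<=` d2)%fset ->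
  galg_mul g1 g2 =
  \sum_(k1 <- d1) \sum_(k2 <- d2) << g1@_k1 * g2@_k2 *g (k1 * k2)%g >>.
Proof.
move=> le_d1 le_d2; rewrite /galg_mul (big_fset_incl _ le_d1) /=.
  apply/eq_bigr=> k1 _; apply/big_fset_incl => // k _ /mcoeff_outdom ->.
  by rewrite mulr0 monalgU0.
move=> k _ /mcoeff_outdom g1k.
by rewrite big1 => // k' _; rewrite g1k mul0r monalgU0.
Qed.

Lemma galg_mulUU c1 c2 k1 k2 :
  galg_mul << c1 *g k1 >> << c2 *g k2 >> = << c1 * c2 *g (k1 * k2)%g >>.
Proof. by rewrite (galg_mulE msuppU_le msuppU_le) !big_seq_fset1 !mcoeffUU. Qed.

Lemma galg_mulDl : left_distributive galg_mul +%R.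
Proof.
move=> g1 g2 g; have s := fsubset_refl (msupp g).
rewrite (galg_mulE (msuppD_le g1 g2) s) (galg_mulE (fsubsetUl _ (msupp g2)) s).
rewrite (galg_mulE (fsubsetUr (msupp g1) _) s) -big_split /=.
apply/eq_bigr=> k1 _; rewrite -big_split /=; apply/eq_bigr=> k2 _.
by rewrite mcoeffD mulrDl monalgUD.
Qed.

Lemma galg_mulDr : right_distributive galg_mul +%R.
Proof.
move=> g g1 g2; have s := fsubset_refl (msupp g).
rewrite (galg_mulE s (msuppD_le g1 g2)) (galg_mulE s (fsubsetUl _ (msupp g2))).
rewrite (galg_mulE s (fsubsetUr (msupp g1) _)) -big_split /=.
apply/eq_bigr=> k1 _; rewrite -big_split /=; apply/eq_bigr=> k2 _.
by rewrite mcoeffD mulrDr monalgUD.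
Qed.

Lemma galg_mul0l g : galg_mul 0 g = 0.
Proof. by rewrite /galg_mul msupp0 big_seq_fset0. Qed.

Lemma galg_mul0r g : galg_mul g 0 = 0.
Proof.
by rewrite /galg_mul big1 // => k _; rewrite msupp0 big_seq_fset0.
Qed.

Lemma galg_mul_suml I (s : seq I) (F : I -> RG) g :
  galg_mul (\sum_(i <- s) F i) g = \sum_(i <- s) galg_mul (F i) g.
Proof.
exact: (big_morph (galg_mul^~ g) (fun x y => galg_mulDl x y g) (galg_mul0l g)).
Qed.

Lemma galg_mul_sumr I (s : seq I) (F : I -> RG) g :
  galg_mul g (\sum_(i <- s) F i) = \sum_(i <- s) galg_mul g (F i).
Proof. exact: (big_morph (galg_mul g) (galg_mulDr g) (galg_mul0r g)). Qed.

Lemma galg_sumE g : g = \sum_(k <- msupp g) (<< g@_k *g k >> : RG).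
Proof. exact: monalgE. Qed.

Lemma galg_mulA : associative galg_mul.
Proof.
move=> g1 g2 g3; rewrite (galg_sumE g1) !galg_mul_suml.
apply/eq_bigr=> k1 _; rewrite (galg_sumE g2) galg_mul_suml !galg_mul_sumr.
rewrite galg_mul_suml; apply/eq_bigr=> k2 _.
rewrite (galg_sumE g3) !galg_mul_sumr; apply/eq_bigr=> k3 _.
by rewrite !galg_mulUU mulrA mulgA.
Qed.

Lemma galg_mul1g : left_id galg_one galg_mul.
Proof.
move=> g; rewrite {1}(galg_sumE g) galg_mul_sumr [RHS]galg_sumE.
by apply/eq_bigr=> k _; rewrite galg_mulUU mul1r mul1g.
Qed.

Lemma galg_mulg1 : right_id galg_one galg_mul.
Proof.
move=> g; rewrite {1}(galg_sumE g) galg_mul_suml [RHS]galg_sumE.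
by apply/eq_bigr=> k _; rewrite galg_mulUU mulr1 mulg1.
Qed.

Lemma galg_one_neq0 : galg_one != 0.
Proof.
by rewrite /galg_one /gbasis; apply/eqP => /eqP; rewrite monalgU_eq0 oner_eq0.
Qed.

HB.instance Definition _ := GRing.Zmodule_isNzRing.Build RG
  galg_mulA galg_mul1g galg_mulg1 galg_mulDl galg_mulDr galg_one_neq0.

Definition galg_unit : pred RG :=
  fun g => `[< exists h : RG, h * g = 1 /\ g * h = 1 >].

Definition galg_inv g : RG :=
  match pselect (exists h : RG, h * g = 1 /\ g * h = 1) with
  | left ex_h => projT1 (cid ex_h)
  | right _ => g
  end.

Lemma galg_mulVr : {in galg_unit, left_inverse 1 galg_inv *%R}.
Proof.
move=> g /asboolP gU; rewrite /galg_inv.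
by case: pselect => // h; case: cid => /= ? [].
Qed.

Lemma galg_divrr : {in galg_unit, right_inverse 1 galg_inv *%R}.
Proof.
move=> g /asboolP gU; rewrite /galg_inv.
by case: pselect => // h; case: cid => /= ? [].
Qed.

Lemma galg_unitP g h : h * g = 1 /\ g * h = 1 -> galg_unit g.
Proof. by move=> hg; apply/asboolP; exists h. Qed.

Lemma galg_inv_out : {in [predC galg_unit], galg_inv =1 id}.
Proof.
by move=> g /asboolPn gU; rewrite /galg_inv; case: pselect.
Qed.

HB.instance Definition _ := GRing.NzRing_hasMulInverse.Build RG
  galg_mulVr galg_divrr galg_unitP galg_inv_out.

Definition nontrivial_unit g : Prop :=
  g \is a GRing.unit /\ ~ (exists k, g = gbasis k).

Definition total_support g : nat := (#|` supp g| + #|` supp g^-1|)%N.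

End GroupAlgebra.

(* The generators a and b are false and true. *)
Definition promislow_rels : seq (word bool * word bool) :=
  let a := (false, false) in let a' := letter_inv a in
  let b := (true, false) in let b' := letter_inv b in
  [:: ([:: b'; a; a; b], [:: a'; a']); ([:: a'; b; b; a], [:: b'; b'])].

Notation promislow := (presented promislow_rels).

Definition F2P : unitRingType := group_algebra 'F_2 promislow.

(* Programs for the mu-recursive functions; a program of type recfun k takes
   k arguments. *)
Inductive recfun : nat -> Type :=
| RZero : recfun 0
| RSucc : recfun 1
| RProj k (i : 'I_k) : recfun k
| RComp m k (f : recfun m) (gs : 'I_m -> recfun k) : recfun k
| RPrec k (f : recfun k) (g : recfun k.+2) : recfun k.+1
| RMu k (f : recfun k.+1) : recfun k.

(* [reval c v y] : the program c halts on the arguments v with output y. In the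
   case of primitive recursion, h lists the intermediate values, and g takes
   the counter, the previous value and the parameters, in this order. *)
Fixpoint reval k (c : recfun k) : k.-tuple nat -> nat -> Prop :=
  match c in recfun k return k.-tuple nat -> nat -> Prop with
  | RZero => fun _ y => y = 0%N
  | RSucc => fun v y => y = (thead v).+1
  | RProj _ i => fun v y => y = tnth v i
  | RComp m _ f gs => fun v y =>
      exists2 w : m.-tuple nat,
        (forall i, reval (gs i) v (tnth w i)) & reval f w y
  | RPrec _ f g => fun v y =>
      exists h : nat -> nat,
        [/\ reval f [tuple of behead v] (h 0%N),
            (forall i, (i < thead v)%N ->
               reval g [tuple of i :: h i :: behead v] (h i.+1))
          & y = h (thead v)]
  | RMu _ f => fun v y =>
      reval f [tuple of y :: v] 0%N /\
      (forall i, (i < y)%N -> exists z, reval f [tuple of i :: v] z.+1)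
  end.

Definition computable (f : nat -> nat) : Prop :=
  exists c : recfun 1, forall n, reval c [tuple n] (f n).

(* The answer yes is coded by 0, so that [RMu c] is the search for the least n
   such that S n. *)
Definition decides (c : recfun 1) (S : nat -> Prop) : Prop :=
  forall n, (S n -> reval c [tuple n] 0%N) /\ (~ S n -> reval c [tuple n] 1%N).

Definition least (S : nat -> Prop) (m : nat) : Prop :=
  S m /\ (forall n, S n -> (m <= n)%N).

Definition nontrivial_unit_of_support (n : nat) : Prop :=
  exists2 u : F2P, nontrivial_unit u & total_support u = n.

(* Main.v *)
Require Import Defs.
From HB Require Import structures.
From mathcomp Require Import all_boot all_order all_fingroup all_algebra.
From mathcomp Require Import generic_quotient finmap zify ring.
From mathcomp.classical Require Import boolp.
From mathcomp.multinomials Require Import monalg.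

(* P is an index-two subgroup of a group structure on Z^3 in which the
   coordinates of a product are [v_c + eps_c w_c], the sign [eps_c] depending
   only on the parities of [v]. A unit and its inverse, of total support n, are
   n elements of P subject to coincidences between their pairwise products; for
   fixed parities each coordinate then is an integral solution of a homogeneous
   linear system in n unknowns whose rows have l1-norm at most 4. Minors of such
   a system are at most 4^n, so by Cramer's rule the solution can be moved, by
   even multiples of small kernel vectors, to one of size 4^n poly(n) with the
   same parities and no new equality between unknowns. Total support n is
   decided by a search among the elements with coordinates in this range, and
   the search for the least n ends because Gardam's unit has total support
   21 + 21. *)

Set Implicit Arguments.
Unset Strict Implicit.
Unset Printing Implicit Defensive.

(** * Small integral solutions of homogeneous systems *)

Section SmallSolutions.

Import Order.TTheory GRing.Theory Num.Theory.
Local Open Scope ring_scope.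

(** What the move must preserve is asymmetric. The equations saying that the two elements are
    mutually inverse are sums of products over [F_2]. They survive as soon as equal products stay
    equal and products equal to 1 stay 1; further coincidences between products only merge terms of
    a sum whose value is still 1. So inequations have to be protected between single elements, never
    between products, and in each coordinate they are of the form [u i != u l].

    Moves are even because parities carry two things at once: the signs that make the system linear,
    and membership in P. Protecting the inequations costs only a polynomial factor, since each
    kernel vector needs [n ^ 2 + 1] candidate multiples. The base 4 counts the factors in an
    equation between two products. *)

Lemma det_le_prod_row_norm (R : numDomainType) n (M : 'M[R]_n) :
  `|\det M| <= \prod_i \sum_j `|M i j|.
Proof.
rewrite bigA_distr_bigA /=.
apply: (le_trans (ler_norm_sum _ _ _)).
rewrite (eq_bigr (fun s : 'S_n => \prod_i `|M i (s i)|)); last first.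
  by move=> s _; rewrite normrM normrX normrN1 expr1n mul1r normr_prod.
pose F (f : {ffun 'I_n -> 'I_n}) := \prod_i `|M i (f i)|.
rewrite (eq_bigr (fun s : 'S_n => F (pval s))); last first.
  by move=> s _; apply: eq_bigr => i _; rewrite pvalE.
rewrite -(big_imset F) /=; last by move=> s t _ _; exact: val_inj.
(* The expanded product of row sums runs over all functions from rows to columns; permutations are
   some of them and the other terms are nonnegative. *)
rewrite [leRHS](bigID (mem [set pval s | s in {: 'S_n}])) /=.
by rewrite lerDl sumr_ge0 // => f _; apply: prodr_ge0.
Qed.

Section KernelProjector.

Variable b : int.
Hypothesis b_ge1 : 1 <= b.

Let b_ge0 : 0 <= b. Proof. exact: le_trans b_ge1. Qed.

Lemma det_le_expn n (M : 'M[int]_n) :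
  (forall i, \sum_j `|M i j| <= b) -> `|\det M| <= b ^+ n.
Proof.
move=> Mb; apply: (le_trans (det_le_prod_row_norm M)).
rewrite -[n in b ^+ n]card_ord -prodr_const.
by apply: ler_prod => i _; rewrite Mb sumr_ge0.
Qed.

Lemma cofactor_le_expn n (M : 'M[int]_n) i j :
  (forall i, \sum_j `|M i j| <= b) -> `|cofactor M i j| <= b ^+ n.-1.
Proof.
move=> Mb; rewrite normrM normrX normrN1 expr1n mul1r.
apply: det_le_expn => k; apply: le_trans (Mb (lift i k)).
rewrite [leRHS](bigD1_ord j) //=.
rewrite [leLHS](eq_bigr (fun l => `|M (lift i k) (lift j l)|)) ?lerDr //.
by move=> l _; rewrite !mxE.
Qed.

(* If [B] is a maximal invertible square submatrix of [A] then, with [E] the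
   inclusion of its columns and [C] the rows of [A] that it meets,
   [1 - E B^-1 C] is a projection onto the kernel of [A]; [K] is its
   multiple by [d = \det B]. *)
Lemma kernel_projector m n (A : 'M[int]_(m, n)) :
  (forall i, \sum_j `|A i j| <= b) ->
  exists d, exists K : 'M[int]_n,
  [/\ d != 0, A *m K = 0, forall u : 'cV_n, A *m u = 0 -> K *m u = d *: u
    & forall i j, `|K i j| <= (n ^ 2).+1%:R * b ^+ n].
Proof.
move=> Ab; pose Aq : 'M[rat]_(m, n) := map_mx intr A.
pose r := \rank Aq; pose f := maxrankfun Aq.
have full : row_full (rowsub f Aq)^T.
  by rewrite /row_full mxrank_tr; exact: maxrowsub_free.
pose g := fullrankfun full.
pose C := rowsub f A; pose B := colsub g C.
pose E : 'M[int]_(n, r) := \matrix_(i, l) (i == g l)%:R.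
have CE : C *m E = B.
  apply/matrixP => k l; rewrite !mxE (bigD1 (g l)) //= !mxE eqxx mulr1.
  by rewrite big1 ?addr0 // => i /negPf ne; rewrite !mxE ne mulr0.
have rn : (r <= n)%N by exact: rank_leq_col.
exists (\det B), ((\det B)%:M - E *m \adj B *m C).
have dn0 : \det B != 0.
  have : map_mx (intr : int -> rat) B^T \in unitmx.
    suff -> : map_mx intr B^T = rowsub g (rowsub f Aq)^T.
      exact: fullrowsub_unit.
    by apply/matrixP => i j; rewrite !mxE.
  by rewrite unitmxE unitfE det_map_mx det_tr intr_eq0.
split=> //.
- have CK : C *m ((\det B)%:M - E *m \adj B *m C) = 0.
    rewrite mulmxBr !mulmxA CE mul_mx_adj mul_mx_scalar mul_scalar_mx.
    by rewrite subrr.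
  (* Over the rationals every row of [A] is a combination of rows of [C], so [C K = 0] already gives
     [A K = 0]. *)
  have /submxP[L AL] : (Aq <= rowsub f Aq)%MS by rewrite eq_maxrowsub.
  apply/matrixP => i j; apply: (@intr_inj rat).
  have := congr1 (fun M => (map_mx intr M : 'M[rat]_(_, _))) CK.
  rewrite map_mxM map_mx0 map_mxsub -/Aq => /(congr1 (mulmx L)).
  rewrite mulmxA -AL mulmx0 -map_mxM => /matrixP /(_ i j).
  by rewrite !mxE.
- move=> u Au; rewrite mulmxBl mul_scalar_mx -!mulmxA mul_rowsub_mx Au.
  by rewrite linear0 !mulmx0 subr0.
have Cb k : \sum_j `|C k j| <= b.
  by under eq_bigr do rewrite mxE; exact: Ab.
have Bb k : \sum_j `|B k j| <= b.
  apply: le_trans (Cb k).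
  rewrite [leRHS](bigID (mem [set g l | l in 'I_r])) /= big_imset /=;
    last first.
    by move=> ? ? _ _; exact: fullrankfun_inj.
  rewrite [leLHS](eq_bigr (fun l => `|C k (g l)|)); last first.
    by move=> l _; rewrite mxE.
  by rewrite lerDl sumr_ge0.
have br : b ^+ r <= b ^+ n by exact: ler_weXn2l.
have Db k j : `|(\adj B *m C) k j| <= r%:R * b ^+ n.
  rewrite mxE; apply: (le_trans (ler_norm_sum _ _ _)).
  rewrite -[r in r%:R]card_ord -sum1_card natr_sum mulr_suml.
  apply: ler_sum => l _; rewrite mul1r normrM mxE; apply: le_trans br.
  (* The cofactor contributes [b ^+ r.-1] and the entry of [C] the remaining factor [b]; the index
     [l] witnesses [0 < r]. *)
  rewrite -[in b ^+ r](@prednK r) ?(leq_ltn_trans _ (ltn_ord l)) // exprSr.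
  rewrite ler_pM ?cofactor_le_expn //; apply: le_trans (Cb l).
  by rewrite (bigD1 j) //= lerDl sumr_ge0.
move=> i j; rewrite -mulmxA !mxE; apply: (le_trans (ler_normB _ _)).
rewrite -natr1 mulrDl mul1r addrC; apply: lerD.
  apply: le_trans (_ : r%:R * (r%:R * b ^+ n) <= _); last first.
    rewrite mulrA -natrM ler_wpM2r ?exprn_ge0 // ler_nat.
    by rewrite -mulnn leq_mul.
  apply: (le_trans (ler_norm_sum _ _ _)).
  rewrite -[X in _ <= X%:R * _]card_ord -sum1_card natr_sum mulr_suml.
  apply: ler_sum => l _; rewrite mul1r normrM mxE; apply: le_trans (Db l j).
  by case: eqP; rewrite ?normr0 ?mul0r // normr1 mul1r.
apply: le_trans br; case: (i == j).
  by rewrite mulr1n det_le_expn.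
by rewrite mulr0n normr0 exprn_ge0.
Qed.

End KernelProjector.

(* The [n ^ 2 + 1] candidate shifts cannot all fail: each pair [(i, l)] with
   [u i != u l] excludes at most one of them. *)
Lemma distinctness_preserving_shift n (u k : 'cV[int]_n) (q : int) :
  exists2 t : nat, (t <= n ^ 2)%N &
  forall i l, u i 0 != u l 0 ->
    (u - (2 * (q - t%:Z)) *: k) i 0 != (u - (2 * (q - t%:Z)) *: k) l 0.
Proof.
pose v (t : nat) := u - (2 * (q - t%:Z)) *: k.
pose bad (t : 'I_(n ^ 2).+1) (x : 'I_n * 'I_n) :=
  (u x.1 0 != u x.2 0) && (v t x.1 0 == v t x.2 0).
case: (boolP [exists t, [forall x, ~~ bad t x]]) => [/existsP[t /forallP H]|].
  exists (t : nat); first by rewrite -ltnS.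
  by move=> i l uil; have := H (i, l); rewrite negb_and uil.
rewrite negb_exists => /forallP H.
have {}H (t : 'I_(n ^ 2).+1) : exists x, bad t x.
  by have := H t; rewrite negb_forall => /existsP[x /negPn]; exists x.
pose h t := xchoose (H t).
have /injectivePn[t [t' ne eqh]] : ~~ injectiveb h.
  apply/negP => /injectiveP /leq_card.
  by rewrite card_prod !card_ord mulnn ltnn.
have /andP[ne1 /eqP e1] := xchooseP (H t).
have /andP[_ /eqP e2] := xchooseP (H t').
rewrite -/(h t') -eqh in e2; rewrite -/(h t) in ne1 e1.
set x := h t in e1 e2 ne1.
rewrite !mxE in e1 e2.
(* A pair excluded by both [t] and [t'] makes this product vanish. If [k] takes equal values on the
   pair, no shift can have identified the two entries of [u]. *)
have : 2 * ((t%:Z - t'%:Z) * (k x.1 0 - k x.2 0)) = 0.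
  transitivity ((u x.1 0 - 2 * (q - t%:Z) * k x.1 0)
    - (u x.2 0 - 2 * (q - t%:Z) * k x.2 0)
    - (u x.1 0 - 2 * (q - t'%:Z) * k x.1 0)
    + (u x.2 0 - 2 * (q - t'%:Z) * k x.2 0)); first by ring.
  by rewrite e1 e2 subrr add0r addNr.
move/eqP; rewrite !mulf_eq0 /= => /orP[/eqP tt'|/eqP k0].
  by case/eqP: ne; apply: val_inj => /=; lia.
by move/eqP: ne1 => []; move/subr0_eq: k0 e1 => ->; exact: addIr.
Qed.

(** Reduction of [u] modulo [2 d], entry by entry, with slack [t j <= n ^ 2] to keep entries
    distinct. Since [K u = d u], subtracting [2 K z] from [u] gives a vector whose [d]-multiple is
    [K (u - 2 d z)]. The entries of [u - 2 d z] are remainders plus [2 d (t j)], at most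
    [|d| * 2 (n ^ 2 + 1)], so [d] cancels and only the size of [K] remains. *)
Lemma small_solution m n (A : 'M[int]_(m, n)) (b : int) (u : 'cV[int]_n) :
  1 <= b -> (forall i, \sum_j `|A i j| <= b) -> A *m u = 0 ->
  exists u' w : 'cV[int]_n,
  [/\ A *m u' = 0, u' = u + 2 *: w,
      forall i l, u i 0 != u l 0 -> u' i 0 != u' l 0
    & forall i, `|u' i 0| <= (n * (n ^ 2).+1 * (2 * (n ^ 2).+1))%:R * b ^+ n].
Proof.
move=> b1 Ab Au.
have [d [K [dn0 AK Ku Kb]]] := kernel_projector b1 Ab.
pose q j : int := divz (u j 0) (2 * d).
pose good (v : 'cV[int]_n) := forall i l, u i 0 != u l 0 -> v i 0 != v l 0.
pose shift (t : 'I_n -> nat) j : 'cV[int]_n :=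
  (2 * (q j - (t j)%:Z)) *: col j K.
have [t tn tu] : exists2 t : 'I_n -> nat, (forall j, t j <= n ^ 2)%N &
    good (u - \sum_j shift t j).
  (* Columns of [K] are treated one at a time, each shift keeping the distinctness secured by the
     earlier ones. *)
  suff: forall s : seq 'I_n, uniq s ->
    exists2 t : 'I_n -> nat, (forall j, t j <= n ^ 2)%N &
      good (u - \sum_(j <- s) shift t j).
    by move=> /(_ _ (index_enum_uniq _)).
  elim=> [_|j s IH /= /andP[js us]].
    by exists (fun=> 0%N) => // i l; rewrite big_nil subr0.
  have [t tn tu] := IH us; set v := u - _ in tu.
  have [t0 t0n t0u] := distinctness_preserving_shift v (col j K) (q j).
  pose t' i := if i == j then t0 else t i.
  exists t' => [i|]; first by rewrite /t'; case: ifP.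
  suff -> : u - \sum_(i <- j :: s) shift t' i
              = v - (2 * (q j - t0%:Z)) *: col j K.
    by move=> i l uil; exact: (t0u i l (tu i l uil)).
  rewrite big_cons {1}/shift /t' eqxx opprD addrC -addrA addrC; congr (_ - _).
  rewrite addrC; congr (u - _); apply: eq_big_seq => i i_s; rewrite /shift.
  by case: eqP i_s js => // -> ->.
pose z : 'cV[int]_n := \col_j (q j - (t j)%:Z).
have sumE : \sum_j shift t j = 2 *: (K *m z).
  apply/colP => i; rewrite !mxE summxE mulr_sumr; apply: eq_bigr => j _.
  by rewrite !mxE; ring.
exists (u - 2 *: (K *m z)), (- (K *m z)); split=> //.
- by rewrite mulmxBr Au -scalemxAr mulmxA AK mul0mx scaler0 subr0.
- by rewrite scalerN.
- by move=> i l uil; rewrite -sumE; exact: tu.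
move=> i; pose v := u - 2 *: (d *: z).
have vE : d *: (u - 2 *: (K *m z)) = K *m v.
  rewrite /v scalerBr mulmxBr (Ku u) // -!scalemxAr; congr (_ - _).
  by rewrite !scalerA mulrC.
have vb j : `|v j 0| <= `|d| * (2 * (n ^ 2).+1)%:R.
  have := divz_eq (u j 0) (2 * d); have := modz_ge0 (u j 0) (_ : 2 * d != 0).
  have := ltz_mod (u j 0) (_ : 2 * d != 0).
  rewrite mulf_neq0 // => /(_ isT) m1 /(_ isT) m0 e.
  have -> : v j 0 = modz (u j 0) (2 * d) + 2 * d * (t j)%:Z.
    by rewrite !mxE {1}e -/(q j); ring.
  apply: le_trans (ler_normD _ _) _; rewrite (ger0_norm m0) !normrM.
  have := tn j; move: m1; rewrite normrM; nia.
rewrite -(ler_pM2l (_ : 0 < `|d|)) ?normr_gt0 //.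
move/colP: vE => /(_ i); rewrite !mxE => /(congr1 (fun x => `|x|)).
rewrite normrM => ->; apply: le_trans (ler_norm_sum _ _ _) _.
rewrite natrM [X in X%:R * _](_ : _ = \sum_(j < n) (n ^ 2).+1)%N; last first.
  by rewrite sum_nat_const card_ord.
rewrite natr_sum !mulr_suml mulr_sumr; apply: ler_sum => j _.
rewrite normrM; apply: le_trans (ler_pM _ _ (Kb i j) (vb j)) _ => //.
by rewrite le_eqVlt; apply/orP; left; apply/eqP; ring.
Qed.

End SmallSolutions.

(** * Recursive functions *)

(* Environments are lists read by position; the value outside the arity k is
   irrelevant. *)
Definition recursive k (f : seq nat -> nat) : Prop :=
  exists c : recfun k, forall v : k.-tuple nat, reval c v (f v).

Lemma recursive_ext k f g :
  (forall v, size v = k -> f v = g v) -> recursive k f -> recursive k g.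
Proof. by move=> fg [c cf]; exists c => v; rewrite -fg ?size_tuple. Qed.

Lemma recursive_var k i : (i < k)%N -> recursive k (nth 0%N ^~ i).
Proof.
move=> ik; exists (RProj (Ordinal ik)) => v /=.
by rewrite (tnth_nth 0%N).
Qed.

Lemma recursive_comp k f (gs : seq (seq nat -> nat)) :
  recursive (size gs) f ->
  (forall i, (i < size gs)%N -> recursive k (nth (fun=> 0%N) gs i)) ->
  recursive k (fun v => f [seq g v | g <- gs]).
Proof.
move=> [c cf] gsP.
have [d dP] := fin_all_exists (fun i : 'I_(size gs) => gsP i (ltn_ord i)).
exists (RComp c d) => v /=.
have sz : size [seq g (val v) | g <- gs] == size gs by rewrite size_map.
exists (Tuple sz); last exact: cf.
by move=> i; rewrite (tnth_nth 0%N) (nth_map (fun=> 0%N)) //; exact: dP.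
Qed.

Lemma recursive_const k c : recursive k (fun=> c).
Proof.
elim: c => [|c IH].
  apply: (@recursive_comp k (fun=> 0%N) [::]) => //.
  by exists RZero.
apply: (@recursive_comp k (fun v => (head 0%N v).+1) [:: fun=> c]).
  by exists RSucc => v /=; case/tupleP: v.
by case.
Qed.

Lemma recursive_prec k f g :
  recursive k f -> recursive k.+2 g ->
  recursive k.+1 (fun v => iteri (head 0%N v)
    (fun i acc => g [:: i, acc & behead v]) (f (behead v))).
Proof.
move=> [c cf] [d dg]; exists (RPrec c d) => v.
exists (fun i =>
  iteri i (fun i acc => g [:: i, acc & behead v]) (f (behead v))).
split=> [|i _ /=|]; [exact: (cf [tuple of behead v])| |by case/tupleP: v].
set a := iteri _ _ _.
exact: (dg [tuple of [:: i, a & [tuple of behead v]]]).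
Qed.

Definition vars n i : seq (seq nat -> nat) :=
  [seq nth 0%N ^~ j | j <- iota i n].

Lemma recursive_vars k n i j :
  (i + n <= k)%N -> (j < n)%N -> recursive k (nth (fun=> 0%N) (vars n i) j).
Proof.
move=> ink jn; rewrite (nth_map 0%N) ?size_iota // nth_iota //.
apply: recursive_var; lia.
Qed.

Lemma eval_vars n i v : (i + n <= size v)%N ->
  [seq g v | g <- vars n i] = take n (drop i v).
Proof.
move=> h; apply: (@eq_from_nth _ 0%N).
  by rewrite !size_map size_iota size_takel // size_drop; lia.
rewrite !size_map size_iota => j jn.
rewrite (nth_map (fun=> 0%N)) ?size_map ?size_iota //.
by rewrite (nth_map 0%N) ?size_iota // nth_iota // nth_take // nth_drop.
Qed.

(** Counter and accumulator are appended to the environment, whereas [RPrec] puts them in front;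
    appending leaves the positions of the older variables unchanged when loops are nested. *)
Lemma recursive_iter k m f g :
  recursive k m -> recursive k f -> recursive k.+2 g ->
  recursive k (fun v => iteri (m v) (fun i acc => g (v ++ [:: i; acc])) (f v)).
Proof.
move=> hm hf hg.
have sz2 : size (vars k 2 ++ vars 2 0) = k.+2.
  by rewrite size_cat !size_map !size_iota addn2.
have hg' : recursive k.+2
    (fun v => g [seq h v | h <- vars k 2 ++ vars 2 0]).
  apply: recursive_comp => [|i]; rewrite sz2 // => ik.
  rewrite nth_cat size_map size_iota; case: ltnP => [ik'|ki].
    exact: recursive_vars.
  by apply: recursive_vars => //; lia.
have sz1 : size (m :: vars k 0) = k.+1 by rewrite /= size_map size_iota.
have := @recursive_comp k _ (m :: vars k 0).
rewrite sz1 => /(_ _ (recursive_prec hf hg')) H.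
have {}H := H (fun i => _).
apply: recursive_ext (H _) => [v sv|[|i] //= ik]; last first.
  exact: recursive_vars.
rewrite /= eval_vars ?sv // drop0 take_oversize ?sv //.
elim: (m v) => //= n ->.
rewrite map_cat !eval_vars /= ?sv ?take0 ?drop0 // take_oversize //.
by rewrite sv.
Qed.

Definition recursive2 (f : nat -> nat -> nat) : Prop :=
  recursive 2 (fun v => f (nth 0%N v 0) (nth 0%N v 1)).

Lemma recursive_op2 k f g h :
  recursive2 f -> recursive k g -> recursive k h ->
  recursive k (fun v => f (g v) (h v)).
Proof.
move=> hf hg hh.
apply: (@recursive_comp k (fun v => f (nth 0%N v 0) (nth 0%N v 1)) [:: g; h]).
  exact: hf.
by case=> [|[]].
Qed.

Lemma recursive_succ k g : recursive k g -> recursive k (fun v => (g v).+1).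
Proof.
move=> hg; apply: (@recursive_comp k (fun v => (head 0%N v).+1) [:: g]).
  by exists RSucc => v /=; case/tupleP: v.
by case.
Qed.

Lemma recursive_pred k g : recursive k g -> recursive k (fun v => (g v).-1).
Proof.
move=> hg; apply: (@recursive_comp k (fun v => (head 0%N v).-1) [:: g]).
  apply: recursive_ext (recursive_prec (recursive_const 0 0)
    (@recursive_var 2 0 isT)) => v _ /=.
  by case: (head 0 v).
by case.
Qed.

Lemma recursive2_iter f g op :
  recursive 2 f -> recursive 4 g ->
  (forall a b,
     op a b = iteri b (fun i acc => g [:: a; b; i; acc]) (f [:: a; b])) ->
  recursive2 op.
Proof.
move=> hf hg opE.
apply: recursive_ext (recursive_iter (@recursive_var 2 1 isT) hf hg).
by move=> [|a [|b []]] //= _; rewrite opE.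
Qed.

Lemma recursive2_addn : recursive2 addn.
Proof.
apply: (@recursive2_iter (nth 0 ^~ 0) (fun v => (nth 0 v 3).+1)).
- exact: recursive_var.
- exact/recursive_succ/recursive_var.
by move=> a; elim=> [|b IH] /=; rewrite ?addn0 // addnS IH.
Qed.

Lemma recursive2_subn : recursive2 subn.
Proof.
apply: (@recursive2_iter (nth 0 ^~ 0) (fun v => (nth 0 v 3).-1)).
- exact: recursive_var.
- exact/recursive_pred/recursive_var.
by move=> a; elim=> [|b IH] /=; rewrite ?subn0 // subnS IH.
Qed.

Lemma recursive2_muln : recursive2 muln.
Proof.
apply: (@recursive2_iter (fun=> 0) (fun v => nth 0 v 3 + nth 0 v 0)).
- exact: recursive_const.
- by apply: recursive_op2; [exact: recursive2_addn|exact: recursive_var..].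
by move=> a; elim=> [|b IH] /=; rewrite ?muln0 // mulnSr IH.
Qed.

Lemma recursive2_expn : recursive2 expn.
Proof.
apply: (@recursive2_iter (fun=> 1) (fun v => nth 0 v 3 * nth 0 v 0)).
- exact: recursive_const.
- by apply: recursive_op2; [exact: recursive2_muln|exact: recursive_var..].
by move=> a; elim=> [|b IH] //=; rewrite expnSr IH.
Qed.

Lemma recursive2_leq : recursive2 (fun a b => a <= b : nat).
Proof.
apply: (@recursive_ext 2 (fun v => 1 - (nth 0 v 0 - nth 0 v 1))).
  by move=> v _; lia.
apply: (recursive_op2 recursive2_subn); first exact: recursive_const.
exact: recursive2_subn.
Qed.

Lemma recursive_sum k g h : recursive k g -> recursive k.+1 h ->
  recursive k (fun v => \sum_(i < g v) h (rcons v i)).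
Proof.
move=> hg hh.
have sz : size (vars k.+1 0) = k.+1 by rewrite size_map size_iota.
have hh' : recursive k.+2 (fun v => h [seq f v | f <- vars k.+1 0]).
  apply: recursive_comp; rewrite sz // => i ik.
  by apply: recursive_vars.
have step : recursive k.+2
    (fun v => nth 0 v k.+1 + h [seq f v | f <- vars k.+1 0]).
  apply: (recursive_op2 recursive2_addn) hh'; exact: recursive_var.
have ev w : size w = k.+2 -> [seq f w | f <- vars k.+1 0] = take k.+1 w.
  by move=> sw; rewrite eval_vars ?drop0 // sw.
move: (vars _ _) ev step => vs ev step.
apply: recursive_ext (recursive_iter hg (recursive_const k 0) step) => v sv.
elim: (g v) => [|n IH] /=; first by rewrite big_ord0.
rewrite big_ord_recr /= -IH; congr (_ + h _).
  by rewrite nth_cat sv ltnNge leqnSn /= subSnn.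
rewrite ev; last by rewrite size_cat sv addn2.
by rewrite -cat_rcons take_size_cat // size_rcons sv.
Qed.

(* Variables are de Bruijn levels: the bound variable of [ESum] in an
   environment of length k is [EVar k]. *)
Inductive expr :=
| EVar of nat
| EConst of nat
| EOp f of recursive2 f & expr & expr
| ESum of expr & expr.

Fixpoint eval e v : nat :=
  match e with
  | EVar i => nth 0 v i
  | EConst c => c
  | EOp f _ e1 e2 => f (eval e1 v) (eval e2 v)
  | ESum e1 e2 => \sum_(i < eval e1 v) eval e2 (rcons v i)
  end.

Fixpoint scoped k e : bool :=
  match e with
  | EVar i => i < k
  | EConst _ => true
  | EOp _ _ e1 e2 => scoped k e1 && scoped k e2
  | ESum e1 e2 => scoped k e1 && scoped k.+1 e2
  end.

Lemma recursive_eval k e : scoped k e -> recursive k (eval e).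
Proof.
elim: e k => [i|c|f hf e1 IH1 e2 IH2|e1 IH1 e2 IH2] k /=.
- exact: recursive_var.
- by move=> _; exact: recursive_const.
- by move=> /andP[/IH1 h1 /IH2 h2]; exact: recursive_op2.
- by move=> /andP[/IH1 h1 /IH2 h2]; exact: recursive_sum.
Qed.

Notation EAdd := (EOp recursive2_addn).
Notation ESub := (EOp recursive2_subn).
Notation EMul := (EOp recursive2_muln).
Notation EExp := (EOp recursive2_expn).
Notation ELe := (EOp recursive2_leq).

Lemma recursive2_divn : recursive2 divn.
Proof.
(* The quotient counts the [i < a] with [(i + 1) * d <= a]; the factor [1 <= d] gives the
   conventional value 0 for [d = 0]. *)
pose e := ESum (EVar 0) (EMul (ELe (EConst 1) (EVar 1))
  (ELe (EMul (EAdd (EVar 2) (EConst 1)) (EVar 1)) (EVar 0))).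
apply: recursive_ext (recursive_eval (_ : scoped 2 e)) => //.
move=> [|a [|d []]] //= _; case: d => [|d].
  by rewrite divn0 big1.
rewrite (eq_bigr (fun i : 'I_a => (i < a %/ d.+1 : nat))); last first.
  by move=> i _; rewrite mul1n addn1 leq_divRL.
rewrite -big_mkcond /= (big_ord_narrow (leq_div a d.+1)).
by rewrite sum1_card card_ord.
Qed.

Notation EDiv := (EOp recursive2_divn).

Lemma recursive2_modn : recursive2 modn.
Proof.
pose e := ESub (EVar 0) (EMul (EDiv (EVar 0) (EVar 1)) (EVar 1)).
apply: recursive_ext (recursive_eval (_ : scoped 2 e)) => //.
by move=> [|a [|d []]] //= _; rewrite {1}(divn_eq a d) addKn.
Qed.

Notation EMod := (EOp recursive2_modn).

(** * The Promislow group *)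

Section IntegerPowers.

Import GRing.Theory.
Local Open Scope group_scope.

Variable G : groupType.
Implicit Types (x y g : G) (i j : int).

Definition zpow x i : G :=
  match i with Posz n => x ^+ n | Negz n => x ^- n.+1 end.

Lemma zpowS x i : zpow x (i + 1)%R = x * zpow x i.
Proof.
case: i => [n|[|n]]; first by rewrite addrC /= -expgS.
  by rewrite /= expg1 mulgV.
have -> : (Negz n.+1 + 1)%R = Negz n by lia.
by rewrite /= [x ^+ n.+2]expgSr invMg mulVKg.
Qed.

Lemma zpowP x i : zpow x (i - 1)%R = x^-1 * zpow x i.
Proof. by rewrite -{2}(subrK 1%R i) zpowS mulKg. Qed.

Lemma zpow_ind (P : int -> Prop) :
  P 0%R -> (forall i, P i -> P (i + 1)%R) -> (forall i, P i -> P (i - 1)%R) ->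
  forall i, P i.
Proof.
move=> P0 PS PP; elim/int_ind => // n; first by rewrite intS addrC; exact: PS.
by rewrite intS opprD addrC; exact: PP.
Qed.

Lemma zpowD x i j : zpow x (i + j)%R = zpow x i * zpow x j.
Proof.
elim/zpow_ind: i => [|i IH|i IH]; first by rewrite add0r mul1g.
  by rewrite addrAC !zpowS IH mulgA.
by rewrite addrAC !zpowP IH mulgA.
Qed.

Lemma zpow_conj g x y i : g * x = y * g -> g * zpow x i = zpow y i * g.
Proof.
move=> gx; have gx' : g * x^-1 = y^-1 * g.
  by apply: (@mulgI _ y); rewrite mulVKg mulgA -gx mulgK.
elim/zpow_ind: i => [|i IH|i IH]; first by rewrite mulg1 mul1g.
  by rewrite !zpowS mulgA gx -mulgA IH mulgA.
by rewrite !zpowP mulgA gx' -mulgA IH mulgA.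
Qed.

Lemma zpowV x i : zpow x^-1 i = zpow x (- i)%R.
Proof.
elim/zpow_ind: i => [|i IH|i IH]; first by rewrite oppr0.
  by rewrite opprD zpowS zpowP IH.
by rewrite opprB [(1 - i)%R]addrC zpowS zpowP invgK IH.
Qed.

End IntegerPowers.

(** * Normal forms derived from the two relations *)

Section PromislowNormalForm.

Import GRing.Theory.
Local Open Scope group_scope.

Variables (G : groupType) (a b x y z : G).
Hypothesis Ra : b^-1 * (a * a) * b = a^-1 * a^-1.
Hypothesis Rb : a^-1 * (b * b) * a = b^-1 * b^-1.
Hypothesis aa : a * a = x.
Hypothesis bb : b * b = y.
Hypothesis abab : a * (b * (a * b)) = z.

Lemma swapV (g u v : G) : g * u = v * g -> g * u^-1 = v^-1 * g.
Proof. by move=> h; apply: (@mulgI _ v); rewrite mulVKg mulgA -h mulgK. Qed.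

Lemma swapA (g u v w : G) : g * u = v * g -> g * (u * w) = v * (g * w).
Proof. by move=> h; rewrite mulgA h mulgA. Qed.

Let aaA w : a * (a * w) = x * w. Proof. by rewrite mulgA aa. Qed.

Lemma swap_b_xV : b * x^-1 = x * b.
Proof. by rewrite -aa invMg -Ra !mulgA mulgV mul1g. Qed.

Lemma swap_a_yV : a * y^-1 = y * a.
Proof. by rewrite -bb invMg -Rb !mulgA mulgV mul1g. Qed.

Lemma swap_b_x : b * x = x^-1 * b.
Proof. by rewrite -[x in LHS]invgK (swapV swap_b_xV). Qed.

Lemma swap_a_y : a * y = y^-1 * a.
Proof. by rewrite -[y in LHS]invgK (swapV swap_a_yV). Qed.

Lemma swap_a_x : a * x = x * a. Proof. by rewrite -aa mulgA. Qed.

Lemma swap_b_y : b * y = y * b. Proof. by rewrite -bb mulgA. Qed.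

(** Conjugation by [a] inverts [y], so conjugation by [x = a a] fixes it. *)
Lemma commute_xy : commute x y.
Proof. by rewrite /commute -{1}aa -mulgA swap_a_y (swapA _ swap_a_yV) aa. Qed.

Lemma babaab : b * (a * (b * (a * (a * b)))) = x * (y^-1 * (b * a)).
Proof.
rewrite aaA (swapA _ swap_b_x) bb.
rewrite (swapA _ (swapV swap_a_x)) swap_a_y (swapA _ swap_b_xV).
by rewrite (swapA _ (swapV swap_b_y)).
Qed.

(** Conjugation by [a] takes [(b a)^2] to [(a b)^2], and conjugation by [b] takes [(a b)^2] to
    [(b a)^2]. Once these squares are known to be mutually inverse, both letters invert [z]. *)
Lemma baba : b * (a * (b * a)) = z^-1.
Proof.
apply: (@mulIg _ z); rewrite mulVg -abab.
transitivity (b * (a * (b * (a * (a * b)))) * (a * b));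
  first by rewrite -!mulgA.
rewrite babaab -!mulgA aaA (swapA _ swap_b_x) bb.
by rewrite (swapA _ (swapV (commute_sym (commuteV commute_xy)))) mulVKg mulVg.
Qed.

Lemma swap_a_z : a * z = z^-1 * a.
Proof.
have h : a * z^-1 = z * a by rewrite -baba -abab -!mulgA.
by rewrite -[z in LHS]invgK (swapV h).
Qed.

Lemma swap_b_z : b * z = z^-1 * b.
Proof. by rewrite -baba -abab -!mulgA. Qed.

Let swap_a_zV : a * z^-1 = z * a.
Proof. by rewrite (swapV swap_a_z) invgK. Qed.

Let swap_b_zV : b * z^-1 = z * b.
Proof. by rewrite (swapV swap_b_z) invgK. Qed.

Lemma commute_xz : commute x z.
Proof. by rewrite /commute -{1}aa -mulgA swap_a_z (swapA _ swap_a_zV) aa. Qed.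

Lemma commute_yz : commute y z.
Proof. by rewrite /commute -{1}bb -mulgA swap_b_z (swapA _ swap_b_zV) bb. Qed.

Lemma ba_normal : b * a = x^-1 * (y * (z^-1 * (a * b))).
Proof.
rewrite -baba -!mulgA babaab (swapA _ (commute_sym commute_xy)).
by rewrite mulKg mulVKg.
Qed.

Definition lat i j k : G := zpow x i * zpow y j * zpow z k.

Lemma latD i j k i' j' k' :
  lat i j k * lat i' j' k' = lat (i + i')%R (j + j')%R (k + k')%R.
Proof.
rewrite /lat !zpowD -!mulgA; congr (_ * _).
have h (u v : G) (m n : int) : commute u v ->
    zpow u m * zpow v n = zpow v n * zpow u m.
  by move=> uv; apply: zpow_conj; apply/esym/zpow_conj.
rewrite (swapA _ (h _ _ k i' (commute_sym commute_xz))).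
rewrite (swapA _ (h _ _ j i' (commute_sym commute_xy))); congr (_ * (_ * _)).
by rewrite (swapA _ (h _ _ k j' (commute_sym commute_yz))).
Qed.

Lemma mul_a_lat i j k : a * lat i j k = lat i (- j)%R (- k)%R * a.
Proof.
rewrite /lat -!mulgA (swapA _ (zpow_conj i swap_a_x)).
rewrite (swapA _ (zpow_conj j swap_a_y)) (zpow_conj k swap_a_z).
by rewrite !zpowV.
Qed.

Lemma mul_b_lat i j k : b * lat i j k = lat (- i)%R j (- k)%R * b.
Proof.
rewrite /lat -!mulgA (swapA _ (zpow_conj i swap_b_x)).
rewrite (swapA _ (zpow_conj j swap_b_y)) (zpow_conj k swap_b_z).
by rewrite !zpowV.
Qed.

(** A translation in the lattice of [x], [y], [z], times one of the coset representatives [1], [a],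
    [b], [a b]. Only existence is derived from the relations; uniqueness comes from the
    coordinates. *)
Definition normal_form g : Prop :=
  exists i j k, exists s t : bool, g = lat i j k * (a ^+ s * b ^+ t).

Lemma normal_form_lat i j k g : normal_form g -> normal_form (lat i j k * g).
Proof.
move=> [i' [j' [k' [s [t ->]]]]].
by exists (i + i')%R, (j + j')%R, (k + k')%R, s, t; rewrite -latD -!mulgA.
Qed.

Lemma normal_form_a g : normal_form g -> normal_form (a * g).
Proof.
move=> [i [j [k [s [t ->]]]]]; rewrite mulgA mul_a_lat -mulgA.
apply: normal_form_lat; case: s => /=; last first.
  by exists 0%R, 0%R, 0%R, true, t; rewrite /lat /= !mul1g.
by exists 1%R, 0%R, 0%R, false, t; rewrite /lat /= !mulg1 mul1g mulgA aa.
Qed.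

Lemma normal_form_b g : normal_form g -> normal_form (b * g).
Proof.
move=> [i [j [k [s [t ->]]]]]; rewrite mulgA mul_b_lat -mulgA.
apply: normal_form_lat; case: s => /=; last first.
  case: t => /=; last by exists 0%R, 0%R, 0%R, false, true;
    rewrite /lat /= !mul1g mulg1.
  by exists 0%R, 1%R, 0%R, false, false; rewrite /lat /= !mul1g !mulg1 bb.
rewrite mulgA ba_normal.
rewrite [_ * (_ * _)](_ : _ = lat (-1)%R 1%R (-1)%R * (a * b)); last first.
  by rewrite /lat /= !expg1 -!mulgA.
rewrite -mulgA; apply: normal_form_lat; case: t => /=; last first.
  by exists 0%R, 0%R, 0%R, true, true; rewrite /lat /= !mul1g mulg1.
exists 0%R, (-1)%R, 0%R, true, false.
by rewrite /lat /= mul1g !mulg1 -mulgA bb swap_a_y.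
Qed.

Lemma normal_form_aV g : normal_form g -> normal_form (a^-1 * g).
Proof.
move=> /normal_form_a /(normal_form_lat (-1)%R 0%R 0%R).
by rewrite /lat /= !mulg1 mulgA expg1 -aa invMg mulgVK.
Qed.

Lemma normal_form_bV g : normal_form g -> normal_form (b^-1 * g).
Proof.
move=> /normal_form_b /(normal_form_lat 0%R (-1)%R 0%R).
by rewrite /lat /= mulg1 mul1g mulgA expg1 -bb invMg mulgVK.
Qed.

Lemma normal_form1 : normal_form 1.
Proof. by exists 0%R, 0%R, 0%R, false, false; rewrite /lat /= !mulg1. Qed.

End PromislowNormalForm.

(** * Faithful integral coordinates and word length *)

Section Coordinates.

Import GRing.Theory Num.Theory.
Local Open Scope ring_scope.

Definition triple : Type := (int * int * int)%type.

Definition parity (m : int) : bool := odd `|m|%N.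

Definition flip (e : bool) (m : int) : int := if e then - m else m.

Lemma parityN m : parity (- m) = parity m.
Proof. by rewrite /parity abszN. Qed.

Lemma parityD m n : parity (m + n) = parity m (+) parity n.
Proof. rewrite /parity; lia. Qed.

Lemma parity_flip e m : parity (flip e m) = parity m.
Proof. by case: e; rewrite /= ?parityN. Qed.

Lemma flipD e m n : flip e (m + n) = flip e m + flip e n.
Proof. by case: e; rewrite //= opprD. Qed.

Lemma flip_flip e e' m : flip e (flip e' m) = flip (e (+) e') m.
Proof. by case: e; case: e'; rewrite //= opprK. Qed.

(* P acts on R^3 by isometries with diagonal linear parts; in suitable
   half-integer coordinates the isometry is [r |-> D r + v] with [v] integral,
   and the signs on the diagonal [D] are determined by the parities of [v].
   [tmul] is the resulting product on the vectors [v]. *)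
Definition tmul (v w : triple) : triple :=
  (v.1.1 + flip (parity v.1.2) w.1.1,
   v.1.2 + flip (parity v.1.1) w.1.2,
   v.2 + flip (parity v.1.1 (+) parity v.1.2) w.2).

Definition tone : triple := (0, 0, 0).

Lemma tmulA : associative tmul.
Proof.
move=> u v w; rewrite /tmul /= !parityD !parity_flip !flipD !flip_flip !addrA.
by congr (_, _, _ + flip _ _); rewrite addbACA.
Qed.

Lemma tmul1v : left_id tone tmul.
Proof. by move=> [[v0 v1] v2]; rewrite /tmul /= !add0r. Qed.

(** [a] and [b] are half turns combined with unit translations along the first and second axes; the
    third coordinate 1 of [a] keeps their axes from meeting. As [a] reverses the third axis, its
    inverse has the same third coordinate. *)
Definition letter_coords (l : bool * bool) : triple :=
  match l with
  | (false, false) => (1, 0, 1)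
  | (false, true) => (-1, 0, 1)
  | (true, false) => (0, 1, 0)
  | (true, true) => (0, -1, 0)
  end.

Definition word_coords (w : word bool) : triple :=
  foldr (fun l => tmul (letter_coords l)) tone w.

Lemma word_coords_cat u v :
  word_coords (u ++ v) = tmul (word_coords u) (word_coords v).
Proof. by elim: u => [|l u IH] /=; rewrite ?tmul1v // IH tmulA. Qed.

Lemma word_coords_eq u v :
  word_eq promislow_rels u v -> word_coords u = word_coords v.
Proof.
elim=> // {u v} [u v w _ -> _ -> //|u u' v v' _ eu _ ev|[[] []]|r] //.
  by rewrite !word_coords_cat eu ev.
by rewrite !inE => /orP[] /eqP ->.
Qed.

Local Notation P := promislow.

Definition coords (g : P) : triple := word_coords (repr g).

Lemma coords_of_word w : coords (of_word promislow_rels w) = word_coords w.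
Proof. exact/word_coords_eq/word_eq_repr. Qed.

Lemma coordsM g h : coords (g * h)%g = tmul (coords g) (coords h).
Proof.
by rewrite -[g]of_word_repr -[h]of_word_repr -of_wordM !coords_of_word
  word_coords_cat.
Qed.

Lemma coords1 : coords 1%g = tone.
Proof. exact: (coords_of_word [::]). Qed.

Let a : P := of_word promislow_rels [:: (false, false)].
Let b : P := of_word promislow_rels [:: (true, false)].
Let x : P := (a * a)%g.
Let y : P := (b * b)%g.
Let z : P := (a * (b * (a * b)))%g.

Let aV : of_word promislow_rels [:: (false, true)] = a^-1%g.
Proof. exact: (of_wordV promislow_rels [:: (false, false)]). Qed.

Let bV : of_word promislow_rels [:: (true, true)] = b^-1%g.
Proof. exact: (of_wordV promislow_rels [:: (true, false)]). Qed.

Lemma of_word_rel r : r \in promislow_rels ->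
  of_word promislow_rels r.1 = of_word promislow_rels r.2.
Proof. by move=> rP; apply/eqP/of_wordP; exact: word_eq_rel. Qed.

Lemma promislow_rel_a : (b^-1 * (a * a) * b = a^-1 * a^-1)%g.
Proof.
have := of_word_rel (mem_nth ([::], [::]) (isT : (0 < size promislow_rels)%N)).
rewrite [nth _ _ _]/= -[X in X = _]/(of_word _ ([:: _] ++ [:: _; _] ++ [:: _])).
rewrite -[X in _ = X]/(of_word _ ([:: _] ++ [:: _])).
rewrite -[in X in X = _](cat1s _ [:: (false, false)]).
by rewrite !of_wordM aV bV mulgA.
Qed.

Lemma promislow_rel_b : (a^-1 * (b * b) * a = b^-1 * b^-1)%g.
Proof.
have := of_word_rel (mem_nth ([::], [::]) (isT : (1 < size promislow_rels)%N)).
rewrite [nth _ _ _]/= -[X in X = _]/(of_word _ ([:: _] ++ [:: _; _] ++ [:: _])).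
rewrite -[X in _ = X]/(of_word _ ([:: _] ++ [:: _])).
rewrite -[in X in X = _](cat1s _ [:: (true, false)]).
by rewrite !of_wordM aV bV mulgA.
Qed.

Lemma promislow_normal_form g : normal_form a b x y z g.
Proof.
have Ra := promislow_rel_a; have Rb := promislow_rel_b.
rewrite -[g]of_word_repr; elim: (repr g) => [|l w IH].
  exact: normal_form1.
rewrite -cat1s of_wordM; case: l => [[] []].
- by rewrite bV; exact: (normal_form_bV Ra Rb).
- exact: (normal_form_b Ra Rb).
- by rewrite aV; exact: (normal_form_aV Ra Rb).
- exact: (normal_form_a Ra Rb).
Qed.

Lemma coordsV1 g h : coords g = h -> tmul h (coords g^-1%g) = tone.
Proof. by move=> <-; rewrite -coordsM mulgV coords1. Qed.

(* By the parity hypotheses [g] acts as a translation. *)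
Lemma coords_zpow g (v : triple) (i : int) :
  ~~ parity v.1.1 -> ~~ parity v.1.2 -> coords g = v ->
  coords (zpow g i) = (i * v.1.1, i * v.1.2, i * v.2).
Proof.
case: v => [[v0 v1] v2] /= /negbTE p0 /negbTE p1 gv.
elim/zpow_ind: i => [|i IH|i IH]; first by rewrite !mul0r /= coords1.
  by rewrite zpowS coordsM gv IH /tmul /= p0 p1 /= !mulrDl !mul1r
    ![_ + i * _]addrC.
rewrite zpowP coordsM IH; have := coordsV1 gv.
rewrite /tmul /= p0 p1 /=; case: (coords _) => [[w0 w1] w2] /= [].
move=> /eqP; rewrite addr_eq0 => /eqP e0.
move=> /eqP; rewrite addr_eq0 => /eqP e1.
move=> /eqP; rewrite addr_eq0 => /eqP e2.
have -> : parity w0 = false by rewrite -[w0]opprK -e0 parityN.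
have -> : parity w1 = false by rewrite -[w1]opprK -e1 parityN.
by rewrite /= e0 e1 e2 !mulrDl !mulN1r !opprK ![_ + i * _]addrC.
Qed.

Lemma coords_normal (i j k : int) (s t : bool) :
  coords (lat x y z i j k * (a ^+ s * b ^+ t))%g =
  (2 * i + s%:Z, 2 * j + flip s t%:Z, 2 * k + s%:Z).
Proof.
have ca : coords a = (1, 0, 1) by rewrite /a coords_of_word.
have cb : coords b = (0, 1, 0) by rewrite /b coords_of_word.
rewrite /lat !coordsM (@coords_zpow x (2, 0, 0)) //; last first.
  by rewrite /x coordsM ca.
rewrite (@coords_zpow y (0, 2, 0)) //; last by rewrite /y coordsM cb.
rewrite (@coords_zpow z (0, 0, 2)) //; last by rewrite /z !coordsM ca cb.
have par2 m : parity (m * 2) = false by rewrite /parity; lia.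
rewrite /tmul /= !mulr0 !par2 /= !addr0 !add0r ?addr0 ?par2 /= !(mulrC 2) ?addr0
  ?par2.
have -> : coords (a ^+ s)%g = (s%:Z, 0, s%:Z) by case: (s); rewrite ?coords1.
have -> : coords (b ^+ t)%g = (0, t%:Z, 0) by case: (t); rewrite ?coords1.
by case: s; case: t; rewrite /= ?oppr0 !addr0.
Qed.

(** The normal form can be read back: the parities of the first two coordinates give [s] and [t],
    and then the coordinates give the lattice exponents. *)
Lemma coords_inj : injective coords.
Proof.
move=> g h; have [i [j [k [s [t ->]]]]] := promislow_normal_form g.
have [i' [j' [k' [s' [t' ->]]]]] := promislow_normal_form h.
rewrite !coords_normal => -[e0 e1 e2].
have es : s = s' by move: e0; case: s {e1 e2}; case: s' => //=; lia.
have et : t = t'.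
  by move: e1; rewrite es; case: t; case: t'; case: s' {es e0 e2} => //=; lia.
by move: e0 e1 e2; rewrite es et => /addIr e0 /addIr e1 /addIr e2;
  congr (lat _ _ _ _ _ _ * _)%g; lia.
Qed.

(** The image of P among all triples, by [coords_valid] and [exists_coords]. *)
Definition valid (v : triple) : bool := parity v.1.1 == parity v.2.

Lemma coords_valid g : valid (coords g).
Proof.
have [i [j [k [s [t ->]]]]] := promislow_normal_form g.
rewrite coords_normal /valid /=.
have par2 m : parity (2 * m) = false by rewrite /parity; lia.
by rewrite !parityD !par2.
Qed.

Lemma word_ballM r s (g h : P) :
  word_ball r g -> word_ball s h -> word_ball (r + s) (g * h)%g.
Proof.
move=> [u ur <-] [v vs <-]; exists (u ++ v); last exact: of_wordM.
by rewrite size_cat leq_add.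
Qed.

Lemma word_ballV r (g : P) : word_ball r g -> word_ball r g^-1%g.
Proof.
move=> [u ur <-]; exists (word_inv u); last exact: of_wordV.
by rewrite size_rev size_map.
Qed.

Lemma word_ball_le r s (g : P) : (r <= s)%N -> word_ball r g -> word_ball s g.
Proof. by move=> rs [u ur <-]; exists u => //; exact: leq_trans rs. Qed.

Lemma word_ballX r n (g : P) : word_ball r g -> word_ball (n * r) (g ^+ n)%g.
Proof.
move=> gr; elim: n => [|n IH]; first by exists [::].
by rewrite expgS mulSn; exact: word_ballM.
Qed.

Lemma word_ball_zpow r i (g : P) :
  word_ball r g -> word_ball (`|i|%N * r) (zpow g i).
Proof.
by case: i => n gr; [exact: word_ballX|apply/word_ballV/word_ballX].
Qed.

(** [x] and [y] have length 2 and [z] has length 4, while the exponents are about half the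
    coordinates, hence the weights 1, 1, 2. The 6 pays for halving odd coordinates (1 + 1 + 2) and
    for the factor [a ^+ s * b ^+ t] (2). *)
Lemma exists_coords (v : triple) : valid v ->
  exists2 g : P, coords g = v &
    word_ball (`|v.1.1| + `|v.1.2| + 2 * `|v.2| + 6)%N g.
Proof.
case: v => [[v0 v1] v2] /eqP /= v02.
pose s := parity v0; pose t := parity v1.
pose i := ((v0 - s%:Z) %/ 2)%Z; pose j := ((v1 - flip s t%:Z) %/ 2)%Z.
pose k := ((v2 - s%:Z) %/ 2)%Z.
have e0 : 2 * i + s%:Z = v0 by rewrite /i /s /parity; lia.
have e1 : 2 * j + flip s t%:Z = v1.
  by rewrite /j /t /flip /parity; case: (s); lia.
have e2 : 2 * k + s%:Z = v2 by rewrite /k /s v02 /parity; lia.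
exists (lat x y z i j k * (a ^+ s * b ^+ t))%g.
  by rewrite coords_normal e0 e1 e2.
have ba : word_ball 1 a by exists [:: (false, false)].
have bb : word_ball 1 b by exists [:: (true, false)].
have bx : word_ball 2 x := word_ballM ba ba.
have by_ : word_ball 2 y := word_ballM bb bb.
have bz : word_ball 4 z := word_ballM ba (word_ballM bb (word_ballM ba bb)).
have bi := word_ball_zpow i bx; have bj := word_ball_zpow j by_.
have bk := word_ball_zpow k bz.
have bs := word_ballX s ba; have bt := word_ballX t bb.
apply: word_ball_le
  (word_ballM (word_ballM (word_ballM bi bj) bk) (word_ballM bs bt)).
move: e0 e1 e2; rewrite -/i -/j -/k /flip /=.
by case: (s); case: (t) => /=; lia.
Qed.

End Coordinates.

(** * Units with small support *)

Section TwistedSystems.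

Import Order.TTheory GRing.Theory Num.Theory.
Local Open Scope ring_scope.

(** The bound of [small_solution] for rows of norm at most 4. *)
Definition coord_bound n : nat := (n * (n ^ 2).+1 * (2 * (n ^ 2).+1) * 4 ^ n)%N.

Variables (n : nat) (s : 'I_n -> bool).

Let twist (u : 'I_n -> int) (q : 'I_n * 'I_n) : int :=
  u q.1 + flip (s q.1) (u q.2).

Let form (q : 'I_n * 'I_n) (l : 'I_n) : int :=
  (l == q.1)%:R + flip (s q.1) (l == q.2)%:R.

Let form_sum q u : \sum_l form q l * u l = twist u q.
Proof.
have pick (k : 'I_n) : \sum_l (l == k)%:R * u l = u k.
  rewrite (bigD1 k) //= eqxx mul1r big1 ?addr0 // => l /negPf ->.
  by rewrite mul0r.
rewrite /twist -[u q.1 in RHS]pick -[u q.2 in RHS]pick /form.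
under eq_bigr do rewrite mulrDl.
rewrite big_split; congr (_ + _); case: (s q.1) => //=.
by rewrite -sumrN; apply: eq_bigr => l _; rewrite mulNr.
Qed.

Let form_norm q : \sum_l `|form q l| <= 2.
Proof.
have pick (k : 'I_n) : \sum_(l < n) (l == k)%:R = 1 :> int.
  rewrite (bigD1 k) //= eqxx big1 ?addr0 // => l /negPf ->.
  by [].
apply: (@le_trans _ _ (\sum_l ((l == q.1)%:R + (l == q.2)%:R))); last first.
  by rewrite big_split /= !pick.
apply: ler_sum => l _; apply: le_trans (ler_normD _ _) _.
by case: (s q.1); rewrite /= ?normrN !normr_nat.
Qed.

(* The homogeneous linear relations of length at most four satisfied by [u]
   are those that encode coincidences between products of elements of P. *)
Lemma small_twisted (u : 'I_n -> int) :
  exists u' : 'I_n -> int,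
  [/\ forall i j k l, u i + flip (s i) (u j) = u k + flip (s k) (u l) ->
        u' i + flip (s i) (u' j) = u' k + flip (s k) (u' l),
      forall i j, u i + flip (s i) (u j) = 0 -> u' i + flip (s i) (u' j) = 0,
      forall i j, u i != u j -> u' i != u' j,
      forall i, parity (u' i) = parity (u i)
    & forall i, (`|u' i| <= coord_bound n)%N].
Proof.
(* Each index is a possible equation: the coordinate of one product equals that of another or, for
   [None], the coordinate 0 of the identity. Equations violated by [u] become zero rows. *)
pose Q := (('I_n * 'I_n) * option ('I_n * 'I_n))%type.
pose holds w (r : Q) := twist w r.1 == oapp (twist w) 0 r.2.
pose row (r : Q) l : int :=
  if holds u r then form r.1 l - oapp (form^~ l) 0 r.2 else 0.
pose A : 'M[int]_(#|{: Q}|, n) := \matrix_(i, l) row (enum_val i) l.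
have rowE w r : \sum_l row r l * w l =
    if holds u r then twist w r.1 - oapp (twist w) 0 r.2 else 0.
  rewrite /row; case: (holds u r); last by rewrite big1 // => l _;
    rewrite mul0r.
  under eq_bigr do rewrite mulrBl.
  rewrite sumrB form_sum; congr (_ - _); case: r.2 => [q|] /=.
    exact: form_sum.
  by rewrite big1 // => l _; rewrite mul0r.
have AE (w : 'cV_n) i : (A *m w) i 0 = \sum_l row (enum_val i) l * w l 0.
  by rewrite mxE; apply: eq_bigr => l _; rewrite mxE.
have A4 i : \sum_j `|A i j| <= 4.
  under eq_bigr do rewrite mxE /row.
  case: (holds u _); last by rewrite big1.
  apply: (@le_trans _ _ (\sum_l (`|form (enum_val i).1 l| +
                        `|oapp (form^~ l) 0 (enum_val i).2|))).
    by apply: ler_sum => l _; exact: ler_normB.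
  rewrite big_split -[4]/(2 + 2 : int) lerD //;
    case: ((enum_val i).2) => [q|] //=.
  by rewrite big1.
have Au : A *m (\col_l u l) = 0.
  apply/colP => i; rewrite AE mxE.
  under eq_bigr do rewrite mxE.
  by rewrite (rowE u); case: ifP => // /eqP ->; rewrite subrr.
have [u' [w [Au' u'w u'ne u'b]]] := small_solution (isT : 1 <= 4 :> int) A4 Au.
have hu' r : holds u r -> twist (u' ^~ 0) r.1 = oapp (twist (u' ^~ 0)) 0 r.2.
  move=> hr; have := AE u' (enum_rank r);
    rewrite Au' mxE enum_rankK (rowE (u' ^~ 0)) hr.
  by move/esym/eqP; rewrite subr_eq0 => /eqP.
exists (u' ^~ 0); split.
- by move=> i j k l e; apply: (hu' ((i, j), Some (k, l))); exact/eqP.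
- by move=> i j e; apply: (hu' ((i, j), None)); exact/eqP.
- by move=> i j; have := u'ne i j; rewrite !mxE.
- by move=> i; rewrite u'w !mxE parityD /parity; move: (u i) (w i 0) => x y;
  lia.
- by move=> i; rewrite -lez_nat abszE -natz natrM natrX; exact: u'b.
Qed.

End TwistedSystems.

Section SmallConfigurations.

Import GRing.Theory.

(** The length in [exists_coords] for three coordinates of size at most [coord_bound n]. *)
Definition radius n : nat := 4 * coord_bound n + 6.

(** With parities fixed, each coordinate of a product depends linearly on that coordinate of the
    factors alone, so the three systems are solved independently. Preserved parities keep the signs
    and the validity of the triples; distinct elements stay distinct in a coordinate where they
    differed. *)
Lemma small_realization n (g : 'I_n -> promislow) :
  exists h : 'I_n -> promislow,
  [/\ forall i j k l, (g i * g j = g k * g l -> h i * h j = h k * h l)%g,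
      forall i j, (g i * g j = 1 -> h i * h j = 1)%g,
      forall i j, h i = h j -> g i = g j,
      forall i, word_ball (radius n) (h i)
    & forall i, [/\ (`|(coords (h i)).1.1| <= coord_bound n)%N,
        (`|(coords (h i)).1.2| <= coord_bound n)%N
      & (`|(coords (h i)).2| <= coord_bound n)%N]].
Proof.
pose v i := coords (g i).
have [u0 [e0 o0 n0 p0 b0]] :=
  small_twisted (fun i => parity (v i).1.2) (fun i => (v i).1.1).
have [u1 [e1 o1 n1 p1 b1]] :=
  small_twisted (fun i => parity (v i).1.1) (fun i => (v i).1.2).
have [u2 [e2 o2 n2 p2 b2]] :=
  small_twisted (fun i => parity (v i).1.1 (+) parity (v i).1.2)
    (fun i => (v i).2).
have val_u i : valid (u0 i, u1 i, u2 i).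
  by rewrite /valid /= p0 p2; exact: coords_valid.
have /fin_all_exists2[h hu hb] i := exists_coords (val_u i).
exists h; split.
- move=> i j k l /(congr1 coords); rewrite !coordsM => -[x0 x1 x2].
  apply: coords_inj; rewrite !coordsM !hu /tmul /= !p0 !p1.
  by rewrite (e0 _ _ _ _ x0) (e1 _ _ _ _ x1) (e2 _ _ _ _ x2).
- move=> i j /(congr1 coords); rewrite coordsM coords1 => -[x0 x1 x2].
  apply: coords_inj; rewrite coordsM coords1 !hu /tmul /= !p0 !p1.
  by rewrite (o0 _ _ x0) (o1 _ _ x1) (o2 _ _ x2).
- move=> i j /(congr1 coords); rewrite !hu => -[x0 x1 x2].
  apply: coords_inj; rewrite -/(v i) -/(v j).
  have y0 : (v i).1.1 = (v j).1.1 by apply/eqP/contraT => /n0; rewrite x0 eqxx.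
  have y1 : (v i).1.2 = (v j).1.2 by apply/eqP/contraT => /n1; rewrite x1 eqxx.
  have y2 : (v i).2 = (v j).2 by apply/eqP/contraT => /n2; rewrite x2 eqxx.
  by move: y0 y1 y2; case: (v i) (v j) => [[? ?] ?] [[? ?] ?] /= -> -> ->.
- move=> i; apply: word_ball_le (hb i) => /=.
  by have := b0 i; have := b1 i; have := b2 i; rewrite /radius; lia.
- by move=> i; rewrite hu; split; [exact: b0|exact: b1|exact: b2].
Qed.

End SmallConfigurations.

(** * Transfer of group algebra identities *)

Section GroupAlgebraTransfer.

Import GRing.Theory.
Local Open Scope ring_scope.

Lemma F2_neq0 (c : 'F_2) : c != 0 -> c = 1.
Proof. by case: c => [[|[|]]] // ? _; exact: val_inj. Qed.

Section Pushforward.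

Variables (R : nzRingType) (G H : groupType) (f : G -> H).

(** The linear extension of a map of sets, meant for sums in which all products are already
    expanded. *)
Definition galg_push (x : group_algebra R G) : group_algebra R H :=
  \sum_(k <- msupp x) (<< x@_k *g f k >> : {malg R[H]}).

Lemma galg_pushE (d : {fset G}) (x : group_algebra R G) :
  (msupp x `<=` d)%fset ->
  galg_push x = \sum_(k <- d) (<< x@_k *g f k >> : {malg R[H]}).
Proof.
move=> xd; rewrite /galg_push (big_fset_incl _ xd) //= => k _ /mcoeff_outdom ->.
by rewrite monalgU0.
Qed.

Lemma galg_pushD : {morph galg_push : x y / x + y}.
Proof.
move=> x y; rewrite (galg_pushE (msuppD_le x y)).
rewrite (galg_pushE (fsubsetUl _ (msupp y)))
  (galg_pushE (fsubsetUr (msupp x) _)).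
rewrite -big_split /=; apply: eq_bigr => k _.
by rewrite mcoeffD monalgUD.
Qed.

Lemma galg_push0 : galg_push 0 = 0.
Proof. by rewrite /galg_push msupp0 big_seq_fset0. Qed.

Lemma galg_push_gbasis k : galg_push (gbasis R k) = gbasis R (f k).
Proof. by rewrite (galg_pushE msuppU_le) big_seq_fset1 mcoeffUU. Qed.

Lemma galg_push_sum I (r : seq I) (Q : pred I) (F : I -> group_algebra R G) :
  galg_push (\sum_(i <- r | Q i) F i) = \sum_(i <- r | Q i) galg_push (F i).
Proof. exact: (big_morph _ galg_pushD galg_push0). Qed.

End Pushforward.

Lemma gbasisM (R : nzRingType) (G : groupType) (k l : G) :
  gbasis R k * gbasis R l = gbasis R (k * l)%g.
Proof. by rewrite [LHS]galg_mulUU mulr1. Qed.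

(** [F i |-> E i] is a well-defined map on the values of [F] and fixes 1, so its linear extension
    carries one identity to the other, however many values of [E] coincide. *)
Lemma sum_gbasis_transfer (R : nzRingType) (G H : groupType) (I : finType)
    (Q : pred I) (F : I -> G) (E : I -> H) :
  (forall i j, F i = F j -> E i = E j) -> (forall i, F i = 1%g -> E i = 1%g) ->
  \sum_(i | Q i) gbasis R (F i) = 1 -> \sum_(i | Q i) gbasis R (E i) = 1.
Proof.
(* The default [1] ensures [f 1 = 1] also when no [F i] is [1]. *)
move=> FE F1; pose f y := if [pick i | F i == y] is Some i then E i else 1%g.
have fF i : f (F i) = E i.
  rewrite /f; case: pickP => [j /eqP /FE //|/(_ i)]; by rewrite eqxx.
have f1 : f 1%g = 1%g by rewrite /f; case: pickP => // j /eqP /F1.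
move/(congr1 (galg_push f)); rewrite galg_push_sum [RHS]galg_push_gbasis f1.
move=> push1; rewrite -[RHS]/(gbasis R 1%g) -push1.
by apply: eq_bigr => i _; rewrite galg_push_gbasis fF.
Qed.

Lemma mcoeff_sum_gbasis (R : nzRingType) (G : groupType) (I : finType)
    (Q : pred I) (F : I -> G) (y : G) :
  (\sum_(i | Q i) gbasis R (F i) : {malg R[G]})@_y
    = (\sum_(i | Q i) (F i == y))%:R.
Proof.
rewrite raddf_sum natr_sum; apply: eq_bigr => i _.
exact: mcoeffU.
Qed.

(** The coefficient at [y] is the parity of the number of [i] with [F i = y]. It vanishes off the
    values of [F], so checking those values suffices once 1 is among them; this makes the test
    finite. *)
Lemma sum_gbasis_eq1 (G : groupType) (I : finType) (Q : pred I) (F : I -> G) :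
  (exists2 i, Q i & F i = 1%g) ->
  (forall i, Q i -> odd (\sum_(j | Q j) (F j == F i)) = (F i == 1%g)) ->
  \sum_(i | Q i) gbasis 'F_2 (F i) = 1.
Proof.
move=> [i0 Qi0 F1] Fodd; apply/malgP => y.
rewrite [LHS]mcoeff_sum_gbasis [RHS]mcoeffU.
have natF2 m : m%:R = (odd m)%:R :> 'F_2.
  by apply: val_inj; rewrite /= !val_Fp_nat // !modn2 oddb.
rewrite natF2; congr (nat_of_bool _)%:R.
have [[i Qi <-]|nF] := pselect (exists2 i, Q i & F i = y).
  by rewrite Fodd // eq_sym.
rewrite big1 /= => [|i Qi]; last by case: eqP => // e; case: nF; exists i.
by case: eqP => // y1; case: nF; exists i0; rewrite // F1.
Qed.

Lemma odd_sum_gbasis (G : groupType) (I : finType) (Q : pred I) (F : I -> G) :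
  \sum_(i | Q i) gbasis 'F_2 (F i) = 1 ->
  forall y, odd (\sum_(j | Q j) (F j == y)) = (y == 1%g).
Proof.
move=> sum1 y; have := mcoeff_sum_gbasis 'F_2 Q F y.
rewrite sum1 [LHS]mcoeffU => /(congr1 (fun c : 'F_2 => nat_of_ord c)).
by rewrite !val_Fp_nat // !modn2 oddb eq_sym; case: (_ == _); case: (odd _).
Qed.

End GroupAlgebraTransfer.

(** * Units as indexed families of group elements *)

Section Configurations.

Import GRing.Theory.
Local Open Scope ring_scope.

Variable G : groupType.
Local Notation FG := (group_algebra 'F_2 G).

(** The first [p] entries list the support of a unit and the others that of its inverse, so
    injectivity is asked within each block only. The two values of [c] give the two orders of
    multiplication. *)
Definition config n p (g : 'I_n -> G) : Prop :=
  (forall i j : 'I_n, (i < p)%N = (j < p)%N -> g i = g j -> i = j) /\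
  (forall c : bool,
    \sum_(q : 'I_n * 'I_n | ((q.1 < p)%N == c) && ((q.2 < p)%N == ~~ c))
      gbasis 'F_2 (g q.1 * g q.2)%g = 1 :> FG).

Lemma sum_pairs n p c (g : 'I_n -> G) :
  \sum_(q : 'I_n * 'I_n | ((q.1 < p)%N == c) && ((q.2 < p)%N == ~~ c))
      gbasis 'F_2 (g q.1 * g q.2)%g =
  (\sum_(i : 'I_n | (i < p)%N == c) gbasis 'F_2 (g i)) *
  (\sum_(i : 'I_n | (i < p)%N == ~~ c) gbasis 'F_2 (g i)) :> FG.
Proof.
rewrite mulr_suml; under [RHS]eq_bigr do rewrite mulr_sumr.
by rewrite pair_big /=; apply: eq_bigr => q _; rewrite gbasisM.
Qed.

Lemma supp_sum_gbasis n (Q : pred 'I_n) (g : 'I_n -> G) :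
  {in Q &, injective g} ->
  supp (\sum_(i | Q i) gbasis 'F_2 (g i)) =
    [fset g i | i in [pred i | Q i]]%fset.
Proof.
move=> g_inj; apply/fsetP => y; rewrite /supp -mcoeff_neq0 mcoeff_sum_gbasis.
apply/idP/imfsetP => [|[i Qi ->]].
  apply: contraNP => nF; rewrite big1 // => i Qi.
  by case: eqP => // e; case: nF; exists i.
rewrite (bigD1 i) //= eqxx big1 ?addn0 // => j /andP[Qj ji].
by case: eqP => // /g_inj e; rewrite e ?eqxx // in ji.
Qed.

(** Over [F_2] a support of size one means a group element, so [p <> 1] expresses nontriviality. *)
Lemma unit_of_config n p (g : 'I_n -> G) :
  (p <= n)%N -> p <> 1%N -> config p g ->
  exists u : FG, [/\ nontrivial_unit u, total_support u = n,
    forall k, k \in supp u -> exists i, k = g i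
  & forall k, k \in supp u^-1 -> exists i, k = g i].
Proof.
move=> pn p1 [g_inj g1].
pose U c : FG := \sum_(i : 'I_n | (i < p)%N == c) gbasis 'F_2 (g i).
have UU c : U c * U (~~ c) = 1 by rewrite -sum_pairs; exact: g1.
have Uu : U true \is a GRing.unit.
  by apply/unitrP; exists (U false); split;
    [exact: (UU false)|exact: (UU true)].
have UV : (U true)^-1 = U false by rewrite -[RHS](mulKr Uu) (UU true) mulr1.
have sU c :
    supp (U c) = [fset g i | i in [pred i : 'I_n | (i < p)%N == c]]%fset.
  apply: supp_sum_gbasis => i j /eqP ic /eqP jc.
  by apply: g_inj; rewrite ic jc.
have cU c : #|` supp (U c)| = #|[pred i : 'I_n | (i < p)%N == c]|.
  rewrite sU card_in_imfset //= => [|i j /eqP ic /eqP jc].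
    by rewrite -cardE.
  by apply: g_inj; rewrite ic jc.
have cUt : #|` supp (U true)| = p.
  rewrite cU -sum1_card (eq_bigl (fun i : 'I_n => (i < p)%N)) => [|i].
    by rewrite (big_ord_narrow pn) sum1_card card_ord.
  by rewrite inE eqb_id.
exists (U true); split.
- split=> // -[k Uk]; apply: p1; rewrite -cUt Uk /supp /gbasis.
  by rewrite msuppU oner_eq0 cardfs1.
- rewrite /total_support UV !cU -[RHS]card_ord.
  rewrite -(cardC [pred i : 'I_n | (i < p)%N == true]).
  by congr addn; apply: eq_card => i; rewrite !inE; case: (_ < _)%N.
- by move=> k; rewrite sU => /imfsetP[i _ ->]; exists i.
- by move=> k; rewrite UV sU => /imfsetP[i _ ->]; exists i.
Qed.

Lemma sum_supp (u : FG) : u = \sum_(k <- supp u) gbasis 'F_2 k.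
Proof.
rewrite [LHS]galg_sumE; apply: eq_big_seq => k.
by rewrite /supp -mcoeff_neq0 => /F2_neq0 ->.
Qed.

Lemma sum_nth_cat (V : nmodType) (T : Type) x0 (s t : seq T) (F : T -> V) c :
  \sum_(i : 'I_(size s + size t) | (i < size s)%N == c) F (nth x0 (s ++ t) i)
  = \sum_(x <- if c then s else t) F x.
Proof.
rewrite big_mkcond big_split_ord /=.
rewrite (eq_bigr (fun i : 'I_(size s) => if c then F (nth x0 s i) else 0));
  last first.
  by move=> i _; rewrite /= nth_cat ltn_ord; case: c.
rewrite addrC.
rewrite (eq_bigr (fun i : 'I_(size t) => if c then 0 else F (nth x0 t i)));
  last first.
  by move=> i _; rewrite /= nth_cat ltnNge leq_addr addKn; case: c.
rewrite [RHS](big_nth x0) big_mkord.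
by case: c; [rewrite big1 ?add0r|rewrite addrC big1 ?add0r].
Qed.

Lemma nth_cat_inj (T : eqType) x0 (s t : seq T) (i j : 'I_(size s + size t)) :
  uniq s -> uniq t -> (i < size s)%N = (j < size s)%N ->
  nth x0 (s ++ t) i = nth x0 (s ++ t) j -> i = j.
Proof.
move=> us ut; rewrite !nth_cat; case: ltnP => i_s; case: ltnP => j_s // _.
  by move/eqP; rewrite nth_uniq // => /eqP /val_inj.
move/eqP; rewrite nth_uniq ?ltn_subLR //.
by rewrite eqn_sub2rE // => /eqP /val_inj.
Qed.

Lemma config_of_unit n (u : FG) :
  nontrivial_unit u -> total_support u = n ->
  exists p, [/\ (p <= n)%N, p <> 1%N & exists g : 'I_n -> G, config p g].
Proof.
move=> [uU u_nt] <-; rewrite /total_support; set s := supp u.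
set t := supp u^-1.
exists (size s); split; first exact: leq_addr.
  move/eqP/cardfs1P => [k sk]; apply: u_nt; exists k.
  by rewrite (sum_supp u) -/s sk big_seq_fset1.
exists (fun i : 'I_(size s + size t) => nth 1%g (s ++ t) i); split.
  by move=> i j; apply: nth_cat_inj; exact: fset_uniq.
move=> c; rewrite (sum_pairs _ _ (fun i => nth 1%g (s ++ t) i)).
rewrite !(sum_nth_cat _ _ _ (@gbasis 'F_2 G)).
have eu : u = \sum_(k <- s) gbasis 'F_2 k by exact: sum_supp.
have ev : u^-1 = \sum_(k <- t) gbasis 'F_2 k by exact: sum_supp.
by case: c; rewrite -eu -ev ?divrr ?mulVr.
Qed.

End Configurations.

Lemma config_transfer (G H : groupType) n p (g : 'I_n -> G) (h : 'I_n -> H) :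
  (forall i j k l, (g i * g j = g k * g l -> h i * h j = h k * h l)%g) ->
  (forall i j, (g i * g j = 1 -> h i * h j = 1)%g) ->
  (forall i j, h i = h j -> g i = g j) ->
  config p g -> config p h.
Proof.
move=> gh2 gh1 hg [g_inj g1]; split=> [i j ij /hg|c]; first exact: g_inj.
apply: sum_gbasis_transfer (g1 c) => [[i j] [k l]|[i j]] /=; first exact: gh2.
exact: gh1.
Qed.

(** * Gardam's unit *)

Section GardamUnit.

Import GRing.Theory.
Local Open Scope ring_scope.

(** The implication under the quantifier makes the choice [elt] total, with an arbitrary value on
    invalid triples. *)
Lemma elt_exists (v : triple) : exists g : promislow, valid v -> coords g = v.
Proof.
case: (boolP (valid v)) => [/exists_coords[g gv _]|_]; last by exists 1%g.
by exists g.
Qed.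

Definition elt (v : triple) : promislow := projT1 (cid (elt_exists v)).

Lemma eltK v : valid v -> coords (elt v) = v.
Proof. by rewrite /elt; case: cid. Qed.

Lemma eltM v w : valid v -> valid w -> elt (tmul v w) = (elt v * elt w)%g.
Proof.
move=> vv vw; have e : coords (elt v * elt w)%g = tmul v w.
  by rewrite coordsM !eltK.
by apply: coords_inj; rewrite e eltK // -e coords_valid.
Qed.

(** Addition in characteristic 2 on lists: a repeated entry annihilates its copy. Gardam's
    identities thereby reduce to an evaluation on integer triples. *)
Definition cancel_pairs (T : eqType) (s : seq T) : seq T :=
  foldr (fun x r => if x \in r then rem x r else x :: r) [::] s.

Lemma sum_cancel_pairs (T : eqType) (V : zmodType) (F : T -> V) (s : seq T) :
  (forall v : V, v + v = 0) ->
  \sum_(x <- s) F x = \sum_(x <- cancel_pairs s) F x.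
Proof.
move=> V2; elim: s => [|x s IH]; first by rewrite !big_nil.
rewrite big_cons IH /=; case: ifP => xr; last by rewrite big_cons.
by rewrite (big_rem x) //= addrA V2 add0r.
Qed.

Lemma group_algebra_F2_addxx (G : groupType) (u : group_algebra 'F_2 G) :
  u + u = 0.
Proof.
apply/malgP => k; rewrite [LHS]mcoeffD mcoeff0; apply: addrr_pchar2.
exact: pchar_Fp.
Qed.

(* With x = a^2, y = b^2, z = (ab)^2 these are the supports of Gardam's unit
   p + q a + r b + s a b, where p = (1+x)(1+y)(1+z^-1),
   q = x^-1 y^-1 + x + y^-1 z + z, r = 1 + x + y^-1 z + x y z and
   s = 1 + (x + x^-1 + y + y^-1) z^-1, and of its inverse. *)
Definition gardam_supp : seq triple :=
  [:: (0, 0, 0); (0, 0, -2); (0, 2, 0); (0, 2, -2); (2, 0, 0); (2, 0, -2);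
      (2, 2, 0); (2, 2, -2); (-1, -2, 1); (3, 0, 1); (1, -2, 3); (1, 0, 3);
      (0, 1, 0); (2, 1, 0); (0, -1, 2); (2, 3, 2); (1, -1, 1); (3, -1, -1);
      (-1, -1, -1); (1, 1, -1); (1, -3, -1)].

Definition gardam_inv_supp : seq triple :=
  [:: (-2, 0, 0); (-2, 0, 2); (-2, -2, 0); (-2, -2, 2); (0, 0, 0); (0, 0, 2);
      (0, -2, 0); (0, -2, 2); (-3, -2, 1); (1, 0, 1); (-1, -2, 3); (-1, 0, 3);
      (0, -1, 0); (2, -1, 0); (0, -3, 2); (2, 1, 2); (1, -1, -1); (3, -1, 1);
      (-1, -1, 1); (1, -3, 1); (1, 1, 1)].

Lemma sum_elt_mul (s t : seq triple) :
  all valid s -> all valid t ->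
  cancel_pairs [seq tmul v w | v <- s, w <- t] = [:: tone] ->
  (\sum_(v <- s) gbasis 'F_2 (elt v)) * (\sum_(w <- t) gbasis 'F_2 (elt w)) = 1.
Proof.
move=> /allP vs /allP vt st; transitivity
    (\sum_(x <- [seq tmul v w | v <- s, w <- t]) gbasis 'F_2 (elt x)).
  rewrite big_allpairs_dep mulr_suml; apply: eq_big_seq => v /vs vv.
  rewrite mulr_sumr; apply: eq_big_seq => w /vt vw.
  by rewrite gbasisM eltM.
rewrite (sum_cancel_pairs _ _ (@group_algebra_F2_addxx _)) st big_seq1.
congr gbasis; apply: coords_inj; rewrite coords1; exact: eltK.
Qed.

Lemma nontrivial_unit_of_supports (s t : seq triple) :
  all valid s -> all valid t -> uniq s -> uniq t -> size s <> 1%N ->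
  cancel_pairs [seq tmul v w | v <- s, w <- t] = [:: tone] ->
  cancel_pairs [seq tmul v w | v <- t, w <- s] = [:: tone] ->
  nontrivial_unit_of_support (size s + size t).
Proof.
move=> vs vt us ut s1 st ts.
have vst k : (k < size s + size t)%N -> valid (nth tone (s ++ t) k).
  rewrite -size_cat => /(mem_nth tone); apply/allP.
  by rewrite all_cat vs vt.
pose g (i : 'I_(size s + size t)) := elt (nth tone (s ++ t) i).
have gc : config (size s) g.
  split=> [i j ij /(congr1 coords)|c].
    rewrite (eltK (vst i (ltn_ord i))) (eltK (vst j (ltn_ord j))).
    exact: nth_cat_inj.
  rewrite (sum_pairs _ _ g).
  rewrite !(sum_nth_cat _ _ _ (fun v => gbasis 'F_2 (elt v))).
  by case: c; apply: sum_elt_mul.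
have [u [u_nt un _ _]] := unit_of_config (leq_addr _ _) s1 gc.
by exists u.
Qed.

Lemma nontrivial_unit_of_support_42 : nontrivial_unit_of_support 42.
Proof.
apply: (@nontrivial_unit_of_supports gardam_supp gardam_inv_supp) => //;
  by vm_compute.
Qed.

End GardamUnit.

(** * The search for units of given total support *)

Section CodedConfigurations.

Import GRing.Theory.

(* Coordinates in [[-R, R]] are coded by naturals in [[0, 2 R]]; the codes of
   the coordinates of a product are shifted by [2 R]. *)
Definition prod_code R (e : bool) a b : nat := a + (if e then 2 * R - b else b).

Section Coded.

Variables (n p R : nat) (X Y Z : nat -> nat).

Definition same i j : bool := [&& X i == X j, Y i == Y j & Z i == Z j].

Definition prodX i j := prod_code R (odd (Y i)) (X i) (X j).
Definition prodY i j := prod_code R (odd (X i)) (Y i) (Y j).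
Definition prodZ i j := prod_code R (odd (X i + Y i)) (Z i) (Z j).

Definition same_prod i j k l : bool :=
  [&& prodX i j == prodX k l, prodY i j == prodY k l & prodZ i j == prodZ k l].

Definition one_prod i j : bool :=
  [&& prodX i j == 2 * R, prodY i j == 2 * R & prodZ i j == 2 * R].

(** The first clause makes the codes decode to elements of P, and the second is injectivity within
    blocks. The last two are the criterion [sum_gbasis_eq1]: some cross product is 1, and a cross
    product occurs an odd number of times exactly when it is 1. *)
Definition coded : bool :=
  [&& [forall i : 'I_n, odd (X i) == odd (Z i)],
      [forall i : 'I_n, forall j : 'I_n,
         ((i < p) == (j < p)) && same i j ==> (val i == val j)],
      [exists i : 'I_n, exists j : 'I_n, [&& i < p, ~~ (j < p) & one_prod i j]]
    & [forall i : 'I_n, forall j : 'I_n, ~~ ((i < p) == (j < p)) ==>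
         (odd (\sum_(k < n) \sum_(l < n)
            [&& (k < p) == (i < p), (l < p) == (j < p) & same_prod k l i j])
          == one_prod i j)]].

Definition decode i : triple :=
  ((X i)%:Z - R%:Z, (Y i)%:Z - R%:Z, (Z i)%:Z - R%:Z)%R.

Hypothesis R_even : ~~ odd R.
Hypothesis XYZ_le : forall i, i < n ->
  [/\ X i <= 2 * R, Y i <= 2 * R & Z i <= 2 * R].

Variable g : 'I_n -> promislow.
Hypothesis gE : forall i, coords (g i) = decode i.

Lemma parity_code m : parity (m%:Z - R%:Z)%R = odd m.
Proof. by move: R_even; rewrite /parity; lia. Qed.

Let eq_code (a b c : nat) : (a%:Z - c%:Z == b%:Z - c%:Z)%R = (a == b).
Proof. by rewrite (inj_eq (addIr _)). Qed.

Lemma same_correct (i j : 'I_n) : (g i == g j) = same i j.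
Proof.
rewrite -(inj_eq coords_inj) !gE /decode /same -!pair_eqE /= -andbA.
by rewrite !eq_code.
Qed.

Lemma coords_mul (i j : 'I_n) : coords (g i * g j)%g =
  ((prodX i j)%:Z - (2 * R)%:Z, (prodY i j)%:Z - (2 * R)%:Z,
   (prodZ i j)%:Z - (2 * R)%:Z)%R.
Proof.
rewrite coordsM !gE /tmul /= !parity_code -oddD.
have [? ? ?] := XYZ_le (ltn_ord j).
rewrite /prodX /prodY /prodZ /prod_code /flip.
by congr (_, _, _); case: odd; lia.
Qed.

Lemma same_prod_correct (i j k l : 'I_n) :
  (g i * g j == g k * g l)%g = same_prod i j k l.
Proof.
rewrite -(inj_eq coords_inj) !coords_mul /same_prod -!pair_eqE /= -andbA.
by rewrite !eq_code.
Qed.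

Lemma one_prod_correct (i j : 'I_n) : (g i * g j == 1)%g = one_prod i j.
Proof.
rewrite -(inj_eq coords_inj) !coords_mul coords1 /one_prod -!pair_eqE /= -andbA.
by rewrite !subr_eq0.
Qed.

Lemma sum_same_prod c (i j : 'I_n) :
  \sum_(q : 'I_n * 'I_n | ((q.1 < p) == c) && ((q.2 < p) == ~~ c))
     (g q.1 * g q.2 == g i * g j)%g =
  \sum_(k < n) \sum_(l < n)
     [&& (k < p) == c, (l < p) == ~~ c & same_prod k l i j].
Proof.
rewrite big_mkcond pair_big /=; apply: eq_bigr => -[k l] _ /=.
by rewrite same_prod_correct andbA; case: (_ && _).
Qed.

Lemma coded_config : coded -> config p g.
Proof.
case/and4P=> _ /forallP inj /existsP[i0 /existsP[j0 /and3P[i0p j0p one0]]].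
move=> /forallP sums; split=> [i j ij e|c].
  have /forallP /(_ j) := inj i; rewrite ij eqxx -same_correct e eqxx.
  by move=> /eqP /val_inj.
have gg : (g i0 * g j0 = 1)%g by apply/eqP; rewrite one_prod_correct.
apply: sum_gbasis_eq1 => [|[i j] /= /andP[/eqP ic /eqP jc]].
  case: c; first by exists (i0, j0); rewrite //= i0p (negbTE j0p).
  (* In a group, a pair with product 1 in one order has product 1 in the other. *)
  exists (j0, i0); rewrite /= ?i0p ?(negbTE j0p) //.
  by rewrite -(mulg1_eq gg) mulVg.
have /forallP /(_ j) := sums i; rewrite one_prod_correct ic jc.
rewrite sum_same_prod => /implyP H; apply/eqP/H.
by case: (c).
Qed.

Lemma config_coded : config p g -> coded.
Proof.
move=> [inj sums]; apply/and4P; split.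
- apply/forallP => i; have := coords_valid (g i).
  by rewrite gE /valid /= !parity_code.
- apply/forallP => i; apply/forallP => j; apply/implyP => /andP[/eqP ij].
  by rewrite -same_correct => /eqP /inj -> //.
- have := odd_sum_gbasis (sums true) 1%g; rewrite eqxx.
  case: (boolP [exists i : 'I_n, _]) => // nex; rewrite big1 // => -[i j] /=.
  move=> /andP[/eqP ip /eqP jp]; case: eqP => // e; case/negP: nex.
  apply/existsP; exists i; apply/existsP; exists j.
  by rewrite ip jp -one_prod_correct e eqxx.
- apply/forallP => i; apply/forallP => j; apply/implyP => ij.
  have := odd_sum_gbasis (sums (i < p)) (g i * g j)%g.
  rewrite sum_same_prod one_prod_correct => <-; apply/eqP; congr odd.
  have jc : (j < p) = ~~ (i < p) by move: ij; case: (i < p); case: (j < p).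
  by apply: eq_bigr => k _; apply: eq_bigr => l _; rewrite jc.
Qed.

End Coded.

(** One number below [M ^ n] codes a given coordinate of all [n] elements, so three bounded numbers
    code a configuration. *)
Definition digit k M i : nat := k %/ M ^ i %% M.

Lemma digits_exist n M (f : 'I_n -> nat) : (forall i, f i < M) ->
  exists2 k, k < M ^ n & forall i : 'I_n, digit k M i = f i.
Proof.
elim: n f => [|n IH] f fM; first by exists 0 => // -[].
have [k kM kf] := IH (fun i => f (lift ord0 i)) (fun i => fM _).
have M0 : 0 < M by exact: leq_trans (fM ord0).
have f0 := fM ord0; exists (f ord0 + k * M).
  rewrite expnSr; apply: leq_trans (_ : k.+1 * M <= _);
    last by rewrite leq_mul2r kM orbT.
  by rewrite mulSn ltn_add2r.
move=> i; case: (unliftP ord0 i) => [j|] -> {i}; last first.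
  by rewrite /digit expn0 divn1 addnC modnMDl modn_small.
by rewrite -kf /digit lift0 expnS divnMA addnC divnMDl // (divn_small f0) addn0.
Qed.

(** An even offset gives a code the parity of the coordinate it stands for. *)
Lemma coord_bound_even n : ~~ odd (coord_bound n).
Proof. by rewrite /coord_bound !oddM /= !andbF. Qed.

(** [small_realization] brings the coordinates of a unit into the searched range; conversely, codes
    passing the test decode through [elt] to a unit. *)
Lemma support_coded n :
  nontrivial_unit_of_support n <->
  exists2 p, (p < n.+1) && (p != 1) &
  exists2 kx, kx < (2 * coord_bound n).+1 ^ n &
  exists2 ky, ky < (2 * coord_bound n).+1 ^ n &
  exists2 kz, kz < (2 * coord_bound n).+1 ^ n &
  coded n p (coord_bound n) (digit kx (2 * coord_bound n).+1)
    (digit ky (2 * coord_bound n).+1) (digit kz (2 * coord_bound n).+1).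
Proof.
set R := coord_bound n; set M := (2 * R).+1.
have digit_le k i : digit k M i <= 2 * R by rewrite -ltnS ltn_mod.
split=> [[u u_nt /(config_of_unit u_nt)[p [pn /eqP p1 [g gc]]]]|].
  have [h [h2 h1 hinj _ hb]] := small_realization g.
  have hc := config_transfer h2 h1 hinj gc.
  have code (v : 'I_n -> int) : (forall i, `|v i|%N <= R) ->
      exists2 k, k < M ^ n & forall i : 'I_n, ((digit k M i)%:Z - R%:Z)%R = v i.
    move=> vR; have [|k kM kE] :=
      @digits_exist n M (fun i => `|(v i + R%:Z)%R|%N).
      by move=> i; have := vR i; rewrite /M; lia.
    by exists k => // i; rewrite kE; have := vR i; lia.
  have [|kx kxM kxE] := code (fun i => (coords (h i)).1.1).
    by move=> i; case: (hb i).
  have [|ky kyM kyE] := code (fun i => (coords (h i)).1.2).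
    by move=> i; case: (hb i).
  have [|kz kzM kzE] := code (fun i => (coords (h i)).2).
    by move=> i; case: (hb i).
  exists p; first by rewrite ltnS pn.
  exists kx => //; exists ky => //; exists kz => //.
  apply: (@config_coded _ _ _ _ _ _ (coord_bound_even n) _ h _ hc) => // i.
  by rewrite /decode kxE kyE kzE; case: (coords _) => -[].
move=> [p /andP[pn /eqP p1] [kx _ [ky _ [kz _ kc]]]].
pose g (i : 'I_n) := elt (decode R (digit kx M) (digit ky M) (digit kz M) i).
have gc : config p g.
  apply: (@coded_config _ _ _ _ _ _ (coord_bound_even n) _ g _ kc) => // i.
  apply: eltK; have /and4P[/forallP /(_ i) /eqP xz _ _ _] := kc.
  by rewrite /valid /= !parity_code ?coord_bound_even // xz.
have [u [u_nt un _ _]] := unit_of_config (pn : p <= n) p1 gc.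
by exists u.
Qed.

End CodedConfigurations.

(** * The search as an arithmetical expression *)

Section SearchProgram.

(** With truth values 0 and 1, products are conjunctions and [ELe] is implication. *)
Definition ENot e := ELe e (EConst 0).
Definition EEq e1 e2 := EMul (ELe e1 e2) (ELe e2 e1).
Definition EEx m e := ELe (EConst 1) (ESum m e).
Definition EAll m e := ENot (ESum m (ENot e)).
Definition EOdd e := EMod e (EConst 2).

Section EvalBool.

Variable v : seq nat.

Lemma eval_not e (b : bool) : eval e v = b -> eval (ENot e) v = ~~ b.
Proof. by move=> /= ->; case: b. Qed.

Lemma eval_and e1 e2 (b1 b2 : bool) :
  eval e1 v = b1 -> eval e2 v = b2 -> eval (EMul e1 e2) v = b1 && b2.
Proof. by move=> /= -> ->; rewrite mulnb. Qed.

Lemma eval_imp e1 e2 (b1 b2 : bool) :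
  eval e1 v = b1 -> eval e2 v = b2 -> eval (ELe e1 e2) v = (b1 ==> b2).
Proof. by move=> /= -> ->; case: b1; case: b2. Qed.

Lemma eval_eq e1 e2 m1 m2 :
  eval e1 v = m1 -> eval e2 v = m2 -> eval (EEq e1 e2) v = (m1 == m2).
Proof. by move=> /= -> ->; rewrite mulnb -eqn_leq. Qed.

Lemma eval_eqb e1 e2 (b1 b2 : bool) :
  eval e1 v = b1 -> eval e2 v = b2 -> eval (EEq e1 e2) v = (b1 == b2).
Proof. by move=> /= -> ->; case: b1; case: b2. Qed.

Lemma eval_odd e m : eval e v = m -> eval (EOdd e) v = odd m.
Proof. by move=> /= ->; rewrite modn2. Qed.

Lemma eval_lt e1 e2 m1 m2 : eval e1 v = m1 -> eval e2 v = m2 ->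
  eval (ELe (EAdd e1 (EConst 1)) e2) v = (m1 < m2).
Proof. by move=> /= -> ->; rewrite addn1. Qed.

End EvalBool.

Section EvalQuantifiers.

Variable v : seq nat.

Lemma eval_sum m e n (f : 'I_n -> nat) :
  eval m v = n -> (forall i : 'I_n, eval e (rcons v i) = f i) ->
  eval (ESum m e) v = \sum_(i < n) f i.
Proof. by move=> mn; case: n / mn f => f ef /=; exact: eq_bigr. Qed.

Lemma eval_ex m e n (b : 'I_n -> bool) :
  eval m v = n -> (forall i : 'I_n, eval e (rcons v i) = b i) ->
  eval (EEx m e) v = [exists i : 'I_n, b i].
Proof.
move=> mn eb; rewrite /= -/(eval (ESum m e) v) (eval_sum mn eb).
congr nat_of_bool; apply/idP/existsP => [|[i bi]].
  apply: contraTP => nex; rewrite big1 // => i _.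
  by case bi: (b i) => //; case: nex; exists i.
by rewrite (bigD1 i) //= bi.
Qed.

Lemma eval_all m e n (b : 'I_n -> bool) :
  eval m v = n -> (forall i : 'I_n, eval e (rcons v i) = b i) ->
  eval (EAll m e) v = [forall i : 'I_n, b i].
Proof.
move=> mn eb; rewrite -[[forall _, _]]negbK negb_forall.
have := eval_ex mn (fun i => eval_not (eb i)).
rewrite /= [in X in _ -> X]leqNgt.
by case: (0 < _); case: [exists _, _].
Qed.

End EvalQuantifiers.

Let N := EVar 0.
Let PP := EVar 1.

Definition ECoordBound : expr :=
  let n1 := EAdd (EExp N (EConst 2)) (EConst 1) in
  EMul (EMul (EMul N n1) (EMul (EConst 2) n1)) (EExp (EConst 4) N).

Lemma eval_coord_bound n v : eval ECoordBound (n :: v) = coord_bound n.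
Proof. by rewrite /= !addn1. Qed.

Let R2 := EMul (EConst 2) ECoordBound.
Let M := EAdd R2 (EConst 1).

Definition EDigit (c i : nat) : expr :=
  EMod (EDiv (EVar c) (EExp M (EVar i))) M.

Definition EProdCode (s : expr) (c i j : nat) : expr :=
  EAdd (EDigit c i) (EAdd (EMul (EOdd s) (ESub R2 (EDigit c j)))
                          (EMul (ENot (EOdd s)) (EDigit c j))).

(* Levels: 0 is n, 1 is p, and 2, 3, 4 code the three coordinates. *)
Let X i := EDigit 2 i.
Let Y i := EDigit 3 i.
Let Z i := EDigit 4 i.
Let PX i j := EProdCode (Y i) 2 i j.
Let PY i j := EProdCode (X i) 3 i j.
Let PZ i j := EProdCode (EAdd (X i) (Y i)) 4 i j.
Let Lt i := ELe (EAdd (EVar i) (EConst 1)) PP.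

(** Levels 5 and 6 are the quantified indices of [coded], levels 7 and 8 its summation indices. *)
Definition ECoded : expr :=
  EMul (EAll N (EEq (EOdd (X 5)) (EOdd (Z 5))))
  (EMul (EAll N (EAll N
     (ELe (EMul (EEq (Lt 5) (Lt 6))
           (EMul (EEq (X 5) (X 6)) (EMul (EEq (Y 5) (Y 6)) (EEq (Z 5) (Z 6)))))
          (EEq (EVar 5) (EVar 6)))))
  (EMul (EEx N (EEx N (EMul (Lt 5) (EMul (ENot (Lt 6))
     (EMul (EEq (PX 5 6) R2) (EMul (EEq (PY 5 6) R2) (EEq (PZ 5 6) R2)))))))
  (EAll N (EAll N (ELe (ENot (EEq (Lt 5) (Lt 6)))
     (EEq (EOdd (ESum N (ESum N
        (EMul (EEq (Lt 7) (Lt 5)) (EMul (EEq (Lt 8) (Lt 6))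
          (EMul (EEq (PX 7 8) (PX 5 6))
            (EMul (EEq (PY 7 8) (PY 5 6)) (EEq (PZ 7 8) (PZ 5 6)))))))))
      (EMul (EEq (PX 5 6) R2) (EMul (EEq (PY 5 6) R2) (EEq (PZ 5 6) R2))))))))).

Lemma eval_digit n v c i :
  eval (EDigit c i) (n :: v) =
  digit (nth 0 (n :: v) c) (2 * coord_bound n).+1 (nth 0 (n :: v) i).
Proof.
rewrite /EDigit /M /R2; move: (eval_coord_bound n v); move: ECoordBound => e.
by rewrite /= => ->; rewrite addn1.
Qed.

Lemma eval_prod_code n v s c i j m : eval s (n :: v) = m ->
  eval (EProdCode s c i j) (n :: v) =
  prod_code (coord_bound n) (odd m)
    (digit (nth 0 (n :: v) c) (2 * coord_bound n).+1 (nth 0 (n :: v) i))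
    (digit (nth 0 (n :: v) c) (2 * coord_bound n).+1 (nth 0 (n :: v) j)).
Proof.
rewrite /EProdCode /R2 => sm; move: (eval_digit n v c i) (eval_digit n v c j).
move: (EDigit c i) (EDigit c j) => di dj ei ej.
move: (eval_coord_bound n v); move: ECoordBound => e en.
move=> /=; rewrite ei ej en sm modn2 /prod_code; case: (odd m) => /=.
  by rewrite mul1n mul0n addn0.
by rewrite mul1n.
Qed.

Lemma eval_R2 n v : eval R2 (n :: v) = 2 * coord_bound n.
Proof. by rewrite /R2 -(eval_coord_bound n v). Qed.

Opaque ECoordBound EDigit EProdCode.

Lemma eval_coded n p kx ky kz :
  eval ECoded [:: n; p; kx; ky; kz] =
  coded n p (coord_bound n) (digit kx (2 * coord_bound n).+1)
    (digit ky (2 * coord_bound n).+1) (digit kz (2 * coord_bound n).+1).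
Proof.
have lt := eval_lt; have dg := eval_digit; have pc := eval_prod_code.
rewrite /coded /same /same_prod /one_prod /prodX /prodY /prodZ.
apply: eval_and.
  apply: eval_all => // i; apply: eval_eqb; apply: eval_odd; exact: dg.
apply: eval_and.
  apply: eval_all => // i; apply: eval_all => // j.
  apply: eval_imp; last exact: eval_eq.
  apply: eval_and; first by apply: eval_eqb; exact: eval_lt.
  by do 2?[apply: eval_and]; apply: eval_eq; exact: dg.
apply: eval_and.
  apply: eval_ex => // i; apply: eval_ex => // j.
  apply: eval_and; first exact: eval_lt.
  apply: eval_and; first by apply: eval_not; exact: eval_lt.
  do 2?[apply: eval_and]; (apply: eval_eq; last exact: eval_R2);
    by apply: pc; rewrite /= ?dg.
apply: eval_all => // i; apply: eval_all => // j.
apply: eval_imp.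
  by apply: eval_not; apply: eval_eqb; exact: eval_lt.
apply: eval_eqb; last first.
  do 2?[apply: eval_and]; (apply: eval_eq; last exact: eval_R2);
    by apply: pc; rewrite /= ?dg.
apply: eval_odd; apply: eval_sum => // k; apply: eval_sum => // l.
apply: eval_and; first by apply: eval_eqb; exact: eval_lt.
apply: eval_and; first by apply: eval_eqb; exact: eval_lt.
do 2?[apply: eval_and]; apply: eval_eq; by apply: pc; rewrite /= ?dg.
Qed.

Definition ESearch : expr :=
  EEx (EAdd N (EConst 1)) (EMul (ENot (EEq PP (EConst 1)))
   (EEx (EExp M N) (EEx (EExp M N) (EEx (EExp M N) ECoded)))).

Lemma eval_search n :
  exists2 b : bool, eval ESearch [:: n] = b &
    (b <-> nontrivial_unit_of_support n).
Proof.
have EM v : eval (EExp M N) (n :: v) = (2 * coord_bound n).+1 ^ n.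
  by rewrite /= eval_coord_bound addn1.
eexists.
  apply: eval_ex => [|p]; first by rewrite /= addn1.
  apply: eval_and; first by apply: eval_not; exact: eval_eq.
  apply: eval_ex => [|kx]; first exact: EM.
  apply: eval_ex => [|ky]; first exact: EM.
  apply: eval_ex => [|kz]; first exact: EM.
  exact: eval_coded.
split=> [/existsP[p] | /support_coded].
  case/andP=> p1 /existsP[kx /existsP[ky /existsP[kz kc]]].
  apply/support_coded; exists p; first by rewrite ltn_ord.
  by exists kx => //; exists ky => //; exists kz.
move=> [p /andP[pn p1] [kx kxM [ky kyM [kz kzM kc]]]].
apply/existsP; exists (Ordinal pn); rewrite p1; apply/existsP;
  exists (Ordinal kxM).
by apply/existsP; exists (Ordinal kyM); apply/existsP; exists (Ordinal kzM).
Qed.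

Transparent ECoordBound EDigit EProdCode.

(** The search is negated because [decides] codes the answer yes by 0. *)
Lemma scoped_search : scoped 1 (ENot ESearch).
Proof. by []. Qed.

Lemma recursive_computable f :
  recursive 1 (fun v => f (nth 0 v 0)) -> computable f.
Proof. by move=> [c cf]; exists c => n; exact: (cf [tuple n]). Qed.

Lemma computable_radius : computable radius.
Proof.
apply: recursive_computable.
pose e := EAdd (EMul (EConst 4) ECoordBound) (EConst 6).
apply: recursive_ext (recursive_eval (_ : scoped 1 e)) => // -[|n []] // _.
by rewrite /e -[RHS]/(4 * coord_bound n + 6) -(eval_coord_bound n [::]).
Qed.

Lemma nontrivial_unit_of_support_decidable :
  exists c : recfun 1, decides c nontrivial_unit_of_support.
Proof.
have [c cE] := recursive_eval scoped_search.
exists c => n; have := cE [tuple n].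
have [b bE bP] := eval_search n.
rewrite (eval_not (bE : eval ESearch [tuple n] = b)).
case: b bP {bE} => /= -[h1 h2] ce; split=> // h.
  by have := h (h1 isT).
by have := h2 h.
Qed.

End SearchProgram.

Lemma least_exists (S : nat -> Prop) n : S n -> exists m, least S m.
Proof.
move=> Sn; have ex : exists m, `[< S m >] by exists n; apply/asboolP.
case: (ex_minnP ex) => m /asboolP Sm min; exists m; split=> // k Sk.
by apply: min; apply/asboolP.
Qed.

Section RadiusBound.

Import GRing.Theory.

Lemma radius_le : exists p : {poly nat},
  forall n, (0 < n)%N -> (radius n <= 4 ^ n * p.[n]%R)%N.
Proof.
pose q : {poly nat} := ('X * 'X + 1%:P)%R.
exists (8%:P * 'X * q * q + 6%:P)%R => n _.
rewrite !(hornerD, hornerM, hornerC, hornerX).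
rewrite -[X in 4 ^ n * X]/(8 * n * (n * n + 1) * (n * n + 1) + 6).
rewrite /radius /coord_bound addn1 mulnn mulnDr.
apply: leq_add; last by rewrite leq_pmull // expn_gt0.
by rewrite leq_eqVlt; apply/orP; left; apply/eqP; ring.
Qed.

End RadiusBound.

Theorem theorem7p2 :
  (exists D : nat -> nat,
     [/\ computable D,
         exists p : {poly nat},
           forall n : nat, (0 < n)%N -> (D n <= 4 ^ n * p.[n]%R)%N
       & forall n : nat, (0 < n)%N ->
           nontrivial_unit_of_support n ->
           exists u : F2P,
             [/\ nontrivial_unit u, total_support u = n,
                 forall g : promislow, g \in supp u -> word_ball (D n) g
               & forall g : promislow,
                   g \in supp (u^-1)%R -> word_ball (D n) g]]) /\
  (exists c : recfun 1,
     decides c nontrivial_unit_of_support /\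
     exists m : nat,
       least nontrivial_unit_of_support m /\ reval (RMu c) [tuple] m).
Proof.
split.
  exists radius; split; [exact: computable_radius|exact: radius_le|].
  move=> n _ [u u_nt /(config_of_unit u_nt)[p [pn p1 [g gc]]]].
  have [h [h2 h1 hinj hball _]] := small_realization g.
  have [w [w_nt wn ws wV]] :=
    unit_of_config pn p1 (config_transfer h2 h1 hinj gc).
  by exists w; split=> // k; [move=> /ws|move=> /wV] => -[i ->].
have [c cS] := nontrivial_unit_of_support_decidable.
have [m mS] := least_exists nontrivial_unit_of_support_42.
exists c; split=> //; exists m; split=> //; case: mS => Sm min; split.
  rewrite (_ : [tuple of m :: [tuple]] = [tuple m]); last exact: val_inj.
  by case: (cS m) => yes _; exact: yes.
(* Below [m] the answer is no, coded by 1, the successor of this 0. *)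
move=> i im; exists 0%N.
rewrite (_ : [tuple of i :: [tuple]] = [tuple i]); last exact: val_inj.
by case: (cS i) => _ no; apply: no => /min; rewrite leqNgt im.
Qed.
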